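(* Let $\{(X_i,x_i)\}_{1\le i\le\infty}$ be a sequence of pointed proper geodesic spaces, $R>0$, and $\upsilon_i$ a Radon measure on $X_i$ for every $i\le\infty$, such that (i) $(X_i,x_i,\upsilon_i)\to(X_\infty,x_\infty,\upsilon_\infty)$ in the pointed measured Gromov-Hausdorff sense and $X_\infty\neq\{x_\infty\}$; (ii) for every $\hat R>0$ there exists $\kappa=\kappa(\hat R)\ge0$ such that $\upsilon_i(B_{2r}(z_i))\le2^\kappa\upsilon_i(B_r(z_i))$ for every $i\le\infty$, every $r<\hat R$ and every $z_i\in X_i$; (iii) $\upsilon_i(B_1(x_i))=1$ for every $i\le\infty$. Let $1<p\le\infty$ and let $g_i\in L^p(B_R(x_i))$ for every $i<\infty$ with $\sup_{i<\infty}\|g_i\|_{L^p}<\infty$. Then there exist $g_\infty\in L^p(B_R(x_\infty))$ and a subsequence $\{g_{i(j)}\}_j$ of $\{g_i\}_i$ such that $g_{i(j)}$ converges weakly to $g_\infty$ on $B_R(x_\infty)$.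
   Context: Pointed measured Gromov-Hausdorff convergence: there are fixed $\epsilon_i\to0$, $R_i\to\infty$ and maps $\psi_i:B_{R_i}(x_i)\to B_{R_i}(x_\infty)$ with $|d(x,y)-d(\psi_i(x),\psi_i(y))|<\epsilon_i$ for all $x,y\in B_{R_i}(x_i)$, $B_{R_i}(x_\infty)\subset B_{\epsilon_i}(\mathrm{Image}\,\psi_i)$, $\psi_i(x_i)\to x_\infty$, and $\upsilon_i(B_r(y_i))\to\upsilon_\infty(B_r(y_\infty))$ for every $r>0$ and every $y_i\to y_\infty$; here $y_i\to y_\infty$ means $\psi_i(y_i)\to y_\infty$. Weak convergence: for $f_i\in L^1_{\mathrm{loc}}(B_R(x_i))$ ($i\le\infty$), $f_i$ converges weakly to $f_\infty$ at $z_\infty\in B_R(x_\infty)$ if for every $z_i\to z_\infty$ $$\liminf_{r\to0}\left(\frac1{\upsilon_\infty(B_r(z_\infty))}\int_{B_r(z_\infty)}f_\infty d\upsilon_\infty-\limsup_{i\to\infty}\frac1{\upsilon_i(B_r(z_i))}\int_{B_r(z_i)}f_id\upsilon_i\right)\ge0$$ and $$\liminf_{r\to0}\left(\liminf_{i\to\infty}\frac1{\upsilon_i(B_r(z_i))}\int_{B_r(z_i)}f_id\upsilon_i-\frac1{\upsilon_\infty(B_r(z_\infty))}\int_{B_r(z_\infty)}f_\infty d\upsilon_\infty\right)\ge0.$$ It converges weakly on $B_R(x_\infty)$ if it does so at every point of $B_R(x_\infty)$. *)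

(* Defs.v *)
From HB Require Import structures.
From mathcomp Require Import all_boot all_order all_algebra.
From mathcomp Require Import all_classical all_reals all_analysis.

Set Implicit Arguments.
Unset Strict Implicit.
Unset Printing Implicit Defensive.

Import Order.TTheory GRing.Theory Num.Theory.
Import numFieldNormedType.Exports.

Local Open Scope classical_set_scope.
Local Open Scope ring_scope.

(* The canonical [point] of such a type is only there because the library's
   measurable types are pointed; the base points x_i are separate data. *)
#[short(type="pmetricType")]
HB.structure Definition PointedMetric (K : numDomainType) :=
  {T of Pointed T & Metric K T}.

Notation borel X := (g_sigma_algebraType (@open X)).

Section metric_spaces.
Context {R : realType}.
Implicit Type X : pmetricType R.

(* The library's [closed_ball] is the closure of the open ball, which in a
   general metric space is smaller than the set used here. *)
Definition proper_space X :=
  forall (x : X) (r : R), compact [set y : X | mdist x y <= r].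

Definition geodesic_space X :=
  forall x y : X, exists gamma : R -> X,
    [/\ gamma 0 = x, gamma (mdist x y) = y &
        forall s t, 0 <= s <= mdist x y -> 0 <= t <= mdist x y ->
          mdist (gamma s) (gamma t) = `|s - t|].

Definition radon_measure X (mu : {measure set (borel X) -> \bar R}) :=
  [/\ forall K : set X, compact K -> (mu K < +oo)%E,
      forall A : set (borel X), measurable A ->
        mu A = ereal_inf [set mu U | U in [set U : set X | open U /\ A `<=` U]] &
      forall U : set X, open U ->
        mu U = ereal_sup [set mu K | K in [set K : set X | compact K /\ K `<=` U]]].

(* L^p(A) for a Borel set A: only the values of f on A matter. *)
Definition in_Lp X (mu : {measure set (borel X) -> \bar R}) (p : \bar R)
    (A : set X) (f : X -> R) : Prop :=
  (f \_ A : borel X -> R) \in Lfun mu p.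

Definition Lp_norm X (mu : {measure set (borel X) -> \bar R}) (p : \bar R)
    (A : set X) (f : X -> R) : \bar R :=
  Lnorm mu p (EFin \o (f \_ A : borel X -> R)).

Definition average X (mu : {measure set (borel X) -> \bar R}) (f : X -> R)
    (A : set X) : \bar R :=
  ((mu A)^-1 * \int[mu]_(y in A) (f y)%:E)%E.

End metric_spaces.

Section convergence.
Context {R : realType} (X : nat -> pmetricType R) (Xoo : pmetricType R).
Variables (x : forall i, X i) (xoo : Xoo).
Variables (rad : nat -> R) (psi : forall i, X i -> Xoo).

(* [psi i] stands for a map defined on the ball of radius [rad i] around
   [x i] only, so its values elsewhere must not be used: y_i --> yoo requires
   y_i to lie in that ball for all large i. *)
Definition cvg_point (y : forall i, X i) (yoo : Xoo) :=
  (\forall i \near \oo, ball (x i) (rad i) (y i)) /\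
  psi (y i) @[i --> \oo] --> yoo.

Variables (mu : forall i, {measure set (borel (X i)) -> \bar R})
  (muoo : {measure set (borel Xoo) -> \bar R}).

Record pmGH_cvg (eps : nat -> R) : Prop := PmGHCvg {
  pmGH_eps : eps i @[i --> \oo] --> 0 ;
  pmGH_rad : rad i @[i --> \oo] --> +oo ;
  pmGH_maps : forall i y, ball (x i) (rad i) y -> ball xoo (rad i) (psi y) ;
  pmGH_dist : forall i y z, ball (x i) (rad i) y -> ball (x i) (rad i) z ->
    `|mdist y z - mdist (psi y) (psi z)| < eps i ;
  pmGH_dense : forall i w, ball xoo (rad i) w ->
    exists2 y, ball (x i) (rad i) y & mdist w (psi y) < eps i ;
  pmGH_base : cvg_point x xoo ;
  pmGH_meas : forall (r : R) y yoo, 0 < r -> cvg_point y yoo ->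
    mu i (ball (y i) r) @[i --> \oo] --> muoo (ball yoo r)
}.

Variables (f : forall i, X i -> R) (foo : Xoo -> R).

(* If the f_i are given on balls of a fixed radius around the x_i, then for r
   small the integrals below only involve these values once i is large. *)
Definition weak_cvg_at (zoo : Xoo) :=
  forall z, cvg_point z zoo ->
  (0 <= limf_einf (fun r : R => average muoo foo (ball zoo r) -
          limn_esup (fun i => average (mu i) (@f i) (ball (z i) r))) 0^'+)%E /\
  (0 <= limf_einf (fun r : R =>
          limn_einf (fun i => average (mu i) (@f i) (ball (z i) r)) -
          average muoo foo (ball zoo r)) 0^'+)%E.

Definition weak_cvg_on (A : set Xoo) := forall zoo, A zoo -> weak_cvg_at zoo.

End convergence.

(* Main.v *)
Require Import Defs.
From HB Require Import structures.
From mathcomp Require Import all_boot all_order all_algebra.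
From mathcomp Require Import all_classical all_reals all_analysis.
From mathcomp Require Import measurable_realfun ring lra.

(** Each finite word [t] of bits selects a Boolean cell of the first [size t] balls
   of a countable family, dense among the balls, inside the ball of radius rho.
   By doubling and geodesicity spheres are null in the limit space, and a Vitali
   argument then shows that the measures of the cells of [X i] converge to those
   of the corresponding cells of the limit.
   A diagonal subsequence makes the integrals of the [g i], and of their
   truncations at every integer level, converge on every cell. Along the cells
   of growing depth the limits for a truncation level form a bounded martingale,
   which is Cauchy in L^1 because its energy increases; since the truncation
   errors are uniformly small, the limits for the [g i] form an L^1-Cauchy
   martingale too, with limit [goo]. By construction the integrals over cells
   converge to those of [goo], and approximating an arbitrary ball from inside by
   balls of the family extends this to averages over balls. Jensen's inequality
   on cells and Fatou's lemma give the L^p bound on [goo]. *)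

Set Implicit Arguments.
Unset Strict Implicit.
Unset Printing Implicit Defensive.

Import Order.TTheory GRing.Theory Num.Theory.
Import numFieldNormedType.Exports.

Local Open Scope classical_set_scope.
Local Open Scope ring_scope.

(** The maps [psi i] are assumed neither continuous nor measurable, so nothing is pushed forward,
    and functions on [X i] and on the limit space are never compared pointwise. Words serve as the
    common index: one word names a cell in every space, and the limit object is at first only a
    function on words. Convergence of measure is given for balls only. For cells, packings by balls
    yield lower bounds; upper bounds follow from additivity, because the cells of one depth fill a
    ball whose measure converges. Orthogonality of martingale differences lives in L^2, while the
    [g i] may lie in L^p with p < 2 only; this is why truncations run alongside. For finite p > 1
    the truncation errors at level k decay like k^(1-p), uniformly in i. This uniform integrability
    keeps the limit martingale from having a singular part and makes thin differences of balls
    harmless. *)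

(** * Completeness of L^1 along a subsequence *)

(** When consecutive L^1 distances are at most 2^-j, the sum [S] of the absolute increments is
    integrable. It gives convergence almost everywhere and, together with the first term, dominates
    the subsequence, so the integrals converge on every [E] along the same [phi]. *)
Lemma L1_cauchy_cvg d (T : measurableType d) (R : realType)
    (mu : {measure set T -> \bar R}) (D : set T) (f : nat -> T -> R) :
  measurable D ->
  (forall n, mu.-integrable D (EFin \o f n)) ->
  (forall e : R, 0 < e -> exists N, forall m n, (N <= n)%N -> (n <= m)%N ->
     \int[mu]_(x in D) `|f m x - f n x| <= e) ->
  exists (g : T -> R) (phi : nat -> nat),
    [/\ forall j, (j <= phi j)%N, measurable_fun D g,
        {ae mu, forall x, D x -> f (phi j) x @[j --> \oo] --> g x} &
        forall E, measurable E -> E `<=` D -> mu.-integrable E (EFin \o g) /\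
          \int[mu]_(x in E) f (phi j) x @[j --> \oo] --> \int[mu]_(x in E) g x].
Proof.
move=> mD fi fC.
have [N NP] := choice (fun j : nat => fC ((2 ^+ j)^-1) (ltac:(by rewrite invr_gt0 exprn_gt0))).
(* The sum makes [phi] nondecreasing while keeping it above both [N j] and [j]. *)
pose phi j := (\sum_(k < j.+1) (N k).+1)%N.
have phiN j : (N j <= phi j)%N by rewrite /phi big_ord_recr /= (leq_trans (leqnSn _))// leq_addl.
have phij j : (j <= phi j)%N.
  by elim: j => // j IH; rewrite /phi big_ord_recr /= addnS ltnS (leq_trans IH)// leq_addr.
have phiS j : (phi j <= phi j.+1)%N by rewrite /phi [leqRHS]big_ord_recr /= leq_addr.
pose dd j x : \bar R := (`|f (phi j.+1) x - f (phi j) x|)%:E.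
have fm n : measurable_fun D (f n) by apply/measurable_EFinP; exact: measurable_int (fi n).
have ddm j : measurable_fun D (dd j).
  by apply/measurable_EFinP/measurableT_comp => //; exact: measurable_funB.
have di m n : mu.-integrable D (EFin \o (fun x => `|f m x - f n x|)).
  apply: integrable_norm; have := integrableB mD (fi m) (fi n).
  by apply: eq_integrable.
have ddle j : (\int[mu]_(x in D) dd j x <= ((2 ^+ j)^-1)%:E)%E.
  have := NP j (phi j.+1) (phi j) (phiN j) (phiS j).
  rewrite -lee_fin; apply: le_trans.
  by rewrite /Rintegral fineK //; apply: (integrable_fin_num mD); exact: di.
pose S x := (\sum_(0 <= j <oo) dd j x)%E.
have S0 x : (0 <= S x)%E by apply: nneseries_ge0 => n _ _; rewrite lee_fin.
have Sm : measurable_fun D S.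
  by apply: ge0_emeasurable_sum => // n x _ _; rewrite lee_fin.
have Si : mu.-integrable D S.
  apply/integrableP; split => //.
  under eq_integral do rewrite gee0_abs//.
  rewrite integral_nneseries//; last by move=> n x _; rewrite lee_fin.
  apply: (@le_lt_trans _ _ (\sum_(0 <= j <oo) (2 / (2 ^ (j + 1))%:R)%:E)%E); last first.
    by have /cvg_lim -> := @cvg_geometric_eseries_half R 2 0; rewrite ?ltry.
  apply: lee_nneseries => [j _ _|j _].
    by apply: integral_ge0 => x _; rewrite lee_fin.
  apply: (le_trans (ddle j)); rewrite lee_fin natrX exprD expr1.
  by rewrite invfM mulrCA divff// mulr1.
(* A limit superior is measurable on all of [D]; [fine] replaces infinite values by 0, which happens
   only on a null subset of [D]. *)
pose g x := fine (limn_esup (fun j => (f (phi j) x)%:E)).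
have gcv : {ae mu, forall x, D x -> f (phi j) x @[j --> \oo] --> g x}.
  have := integrable_ae mD Si; apply: filterS => x /[apply] Sx.
  have c1 : cvgn [normed series (telescope (fun j => f (phi j) x))].
    apply: nondecreasing_is_cvgn.
      by apply: nondecreasing_series => n _ /=.
    exists (fine (S x)) => _ [n _ <-] /=.
    rewrite -lee_fin fineK// /series /= -sumEFin.
    by apply: (nneseries_lim_ge (u_ := dd ^~ x)) => k _ _; rewrite lee_fin.
  have c2 := normed_cvg c1.
  have c3 : cvgn (fun j => f (phi j) x).
    have -> : (fun j => f (phi j) x) =
      (fun j => f (phi 0%N) x + series (telescope (fun j => f (phi j) x)) j).
      by apply/funext => j; rewrite telescopeK /= addrC subrK.
    by apply: is_cvgD => //; exact: is_cvg_cst.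
  suff -> : g x = limn (fun j => f (phi j) x) by [].
  rewrite /g.
  have /cvg_limn_einf_sup[_ ->] : (f (phi j) x)%:E @[j --> \oo] --> (limn (fun j => f (phi j) x))%:E.
    by apply: cvg_EFin => //; exact: nearW.
  by [].
have gm : measurable_fun D g.
  apply: measurableT_comp => //; apply: measurable_fun_limn_esup => n.
  exact/measurable_EFinP.
exists g, phi; split => // E mE ED.
pose h x := (`|f (phi 0%N) x|%:E + S x)%E.
have hi : mu.-integrable E h.
  apply: (integrableS mD) => //; apply: integrableD => //.
  exact: (integrable_norm (fi _)).
have fh j x : (`|(f (phi j) x)%:E| <= h x)%E.
  rewrite (eq_sum_telescope (fun j => f (phi j) x) j) abse_EFin.
  apply: (@le_trans _ _ (`|f (phi 0%N) x|%:E + `|series (telescope (fun j => f (phi j) x)) j|%:E)%E).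
    by rewrite -EFinD lee_fin ler_normD.
  rewrite /h leeD2l//.
  apply: (@le_trans _ _ (\sum_(0 <= i < j) dd i x)%E).
    by rewrite /dd sumEFin lee_fin /series /= ler_norm_sum.
  by apply: (nneseries_lim_ge (u_ := dd ^~ x)) => k _ _; rewrite lee_fin.
have [] := @dominated_convergence _ _ _ mu E mE (fun j => EFin \o f (phi j)) (EFin \o g) h.
- by move=> n; apply/measurable_EFinP; apply: measurable_funS (fm _).
- by apply/measurable_EFinP; apply: measurable_funS gm.
- apply: filterS gcv => x gx Ex; apply: cvg_EFin; first exact: nearW.
  exact: gx (ED _ Ex).
- exact: hi.
- by apply: aeW => x n _; exact: fh.
move=> gi _ cvg; split => //.
apply: fine_cvg; rewrite fineK //; exact: integrable_fin_num gi.
Qed.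

(** * Boolean cells and tree martingales *)

(** Words grow at the end: the children of [t] are its two extensions by [rcons], and its ancestor
    of depth [n] is [take n t]. *)
Fixpoint words (n : nat) : seq (seq bool) :=
  if n is n'.+1 then
    [seq rcons t true | t <- words n'] ++ [seq rcons t false | t <- words n']
  else [:: [::]].

Lemma size_words n t : t \in words n -> size t = n.
Proof.
elim: n t => [|n IH] t /=; first by rewrite inE => /eqP ->.
by rewrite mem_cat => /orP[] /mapP[s /IH <- ->]; rewrite size_rcons.
Qed.

Lemma mem_words t : t \in words (size t).
Proof.
elim/last_ind: t => [//|t b IH]; rewrite size_rcons /= mem_cat.
by case: b; apply/orP; [left|right]; apply/mapP; exists t.
Qed.

Section words_sum.
Variable V : nmodType.

Lemma sum_words0 (f : seq bool -> V) : \sum_(t <- words 0) f t = f [::].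
Proof. by rewrite /= big_seq1. Qed.

Lemma sum_wordsS n (f : seq bool -> V) : \sum_(t <- words n.+1) f t =
  \sum_(t <- words n) (f (rcons t true) + f (rcons t false)).
Proof. by rewrite /= big_cat !big_map big_split. Qed.

Definition tree_additive (F : seq bool -> V) :=
  forall t, F t = F (rcons t true) + F (rcons t false).

Lemma sum_words_additive (F : seq bool -> V) n :
  tree_additive F -> \sum_(t <- words n) F t = F [::].
Proof.
move=> FD; elim: n => [|n <-]; first exact: sum_words0.
by rewrite sum_wordsS; apply: eq_bigr => t _; rewrite -FD.
Qed.

End words_sum.

(** The tower property of conditional expectations: a coefficient depending on the first [n] bits
    only factors out of the sum over the descendants of a word of length [n], and additivity of [F]
    collapses that sum. *)
Lemma sum_words_take (R : pzRingType) (c F : seq bool -> R) n m :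
  tree_additive F -> (n <= m)%N ->
  \sum_(t <- words m) c (take n t) * F t = \sum_(t <- words n) c t * F t.
Proof.
move=> FD /subnK <-; elim: (m - n)%N => [|k IH].
  rewrite add0n; apply: eq_big_seq => t /size_words <-.
  by rewrite take_size.
rewrite addSn sum_wordsS -IH; apply: eq_big_seq => t /size_words tn.
by rewrite -!cats1 !takel_cat ?tn ?leq_addl// -mulrDr !cats1 -FD.
Qed.

Lemma ler_term_words (R : numDomainType) (f : seq bool -> R) (t : seq bool) :
  (forall s, 0 <= f s) -> f t <= \sum_(s <- words (size t)) f s.
Proof.
move=> f0; rewrite (big_rem t) ?mem_words//= lerDl.
exact: sumr_ge0.
Qed.

Section cell.
Context {T : Type}.
Implicit Types (D : set T) (B : nat -> set T).

(** The address of [y]: functions of the form [h (code B n y)] are the step functions on the cells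
    of depth [n]. *)
Definition code B n (y : T) : seq bool := mkseq (fun j => y \in B j) n.

Definition cell D B (t : seq bool) : set T :=
  D `&` [set y | code B (size t) y = t].

Lemma codeS B n y : code B n.+1 y = rcons (code B n y) (y \in B n).
Proof. by rewrite /code mkseqS. Qed.

Lemma take_code B n m y : (n <= m)%N -> take n (code B m y) = code B n y.
Proof. by move=> nm; rewrite /code /mkseq -map_take take_iota (minn_idPl nm). Qed.

Lemma cell_sub D B t : cell D B t `<=` D.
Proof. by move=> y []. Qed.

Lemma cell_nil D B : cell D B [::] = D.
Proof. by apply/seteqP; split => [y []|y Dy]. Qed.

Lemma cell_rcons D B t b : cell D B (rcons t b) =
  cell D B t `&` (if b then B (size t) else ~` B (size t)).
Proof.
apply/seteqP; split => y; rewrite /cell /= size_rcons codeS.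
  move=> [Dy /rcons_inj[-> yb]]; split => //.
  by case: b yb; [move/set_mem|move/negbT; rewrite notin_setE].
move=> [[Dy ty] yb]; split => //; rewrite ty; congr rcons.
by case: b yb => yb; [rewrite mem_set|rewrite memNset].
Qed.

Lemma cell_rconsU D B t :
  cell D B t = cell D B (rcons t true) `|` cell D B (rcons t false).
Proof. by rewrite !cell_rcons -setIUr setUCr setIT. Qed.

Lemma cell_rconsI D B t :
  [disjoint cell D B (rcons t true) & cell D B (rcons t false)].
Proof.
by rewrite !cell_rcons; apply/eqP; rewrite setIACA setICr setI0.
Qed.

End cell.

Section cell_measure.
Context d (T : measurableType d) (R : realType) (mu : {measure set T -> \bar R}).
Variables (D : set T) (B : nat -> set T).
Hypotheses (mD : measurable D) (mB : forall j, measurable (B j)).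

Lemma measurable_cell t : measurable (cell D B t).
Proof.
elim/last_ind: t => [|t b IH]; first by rewrite cell_nil.
by rewrite cell_rcons; apply: measurableI => //; case: b => //; exact: measurableC.
Qed.

Lemma Rintegral_cell_additive (f : T -> R) : mu.-integrable D (EFin \o f) ->
  tree_additive (fun t => \int[mu]_(x in cell D B t) f x).
Proof.
move=> fi t; rewrite [in LHS]cell_rconsU Rintegral_setU//.
- exact: measurable_cell.
- exact: measurable_cell.
- rewrite -cell_rconsU; apply: integrableS fi => //; first exact: measurable_cell.
  exact: cell_sub.
- exact: cell_rconsI.
Qed.

Lemma Rintegral_words (f : T -> R) n : mu.-integrable D (EFin \o f) ->
  \sum_(t <- words n) \int[mu]_(x in cell D B t) f x = \int[mu]_(x in D) f x.
Proof.
by move=> /Rintegral_cell_additive/sum_words_additive ->; rewrite cell_nil.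
Qed.

Hypothesis (muD : (mu D < +oo)%E).

Lemma fin_num_measure_sub E : measurable E -> E `<=` D -> mu E \is a fin_num.
Proof.
move=> mE ED; rewrite ge0_fin_numE//; apply: le_lt_trans muD.
by apply: le_measure => //; rewrite inE.
Qed.

Lemma fine_cell_additive : tree_additive (fun t => fine (mu (cell D B t))).
Proof.
move=> t; rewrite {1}cell_rconsU measureU //; [|exact: measurable_cell..|].
  by rewrite fineD//; apply: fin_num_measure_sub => //;
    (exact: measurable_cell || exact: cell_sub).
exact/eqP/cell_rconsI.
Qed.

Lemma measurable_code (h : seq bool -> R) n :
  measurable_fun setT (fun x => h (code B n x)).
Proof.
elim: n h => [|n IH] h; first exact: (measurable_cst (h [::])).
under eq_fun do rewrite codeS.
rewrite (_ : (fun _ => _) = (fun x => if x \in B n then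
   h (rcons (code B n x) true) else h (rcons (code B n x) false))).
  apply: measurable_fun_ifT; [|exact: (IH (fun s => h (rcons s true)))|
    exact: (IH (fun s => h (rcons s false)))].
  apply: (measurable_fun_bool true) => //=.
  rewrite setTI (_ : _ @^-1` _ = B n) //.
  by apply/seteqP; split => x /=; [move=> /set_mem|move=> /mem_set ->].
by apply/funext => x; case: (x \in B n).
Qed.

Lemma code_words n x : code B n x \in words n.
Proof. by rewrite -[n in words n](size_mkseq (fun j => x \in B j)) mem_words. Qed.

Lemma integrable_code (h : seq bool -> R) n E : measurable E -> E `<=` D ->
  mu.-integrable E (EFin \o (fun x => h (code B n x))).
Proof.
move=> mE ED; apply: measurable_bounded_integrable => //.
- by rewrite -ge0_fin_numE//; exact: fin_num_measure_sub.
- exact: measurable_funTS (measurable_code _ _).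
exists (\sum_(t <- words n) `|h t|); split; first exact: num_real.
move=> M Mh x Ex; apply: ltW; apply: le_lt_trans Mh.
rewrite (big_rem _ (code_words n x)) /= lerDl; exact: sumr_ge0.
Qed.

Lemma Rintegral_code_cell (h : seq bool -> R) n t : (n <= size t)%N ->
  \int[mu]_(x in cell D B t) h (code B n x) =
  h (take n t) * fine (mu (cell D B t)).
Proof.
move=> nt; rewrite -Rintegral_cst; last exact: measurable_cell.
apply: eq_Rintegral => x /set_mem[_ /= <-].
by rewrite take_code// size_mkseq.
Qed.

Lemma Rintegral_code (h : seq bool -> R) n :
  \int[mu]_(x in D) h (code B n x) =
  \sum_(t <- words n) h t * fine (mu (cell D B t)).
Proof.
rewrite -(Rintegral_words n (integrable_code _ _ mD (@subset_refl _ _))).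
apply: eq_big_seq => t /size_words tn.
by rewrite Rintegral_code_cell ?tn// -tn take_size.
Qed.

End cell_measure.

(** [D] cut by the [j]-th set is the union of the cells of depth [j.+1] whose last bit is true.
    Integrals over reference balls thus reduce to finitely many cells. *)
Lemma Rintegral_setI_cells d (T : measurableType d) (R : realType)
    (mu : {measure set T -> \bar R}) (D : set T) (B : nat -> set T) (f : T -> R) j :
  measurable D -> (forall j, measurable (B j)) -> mu.-integrable D (EFin \o f) ->
  \int[mu]_(x in D `&` B j) f x =
  \sum_(t <- words j) \int[mu]_(x in cell D B (rcons t true)) f x.
Proof.
move=> mD mB fi; have mDj : measurable (D `&` B j) by exact: measurableI.
rewrite -(Rintegral_words mDj mB j); last by apply: integrableS fi => // y [].
apply: eq_big_seq => t /size_words tj; congr (Rintegral mu _ f).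
by rewrite cell_rcons tj /cell setIAC.
Qed.

Section tree_energy.
Variables (R : realType) (m F : seq bool -> R) (k : R).
Hypotheses (mD : tree_additive m) (FD : tree_additive F).
Hypotheses (Fm : forall t, `|F t| <= k * m t) (m0 : forall t, 0 <= m t).

(** Division by 0 yields 0, so [a] vanishes on cells of measure 0; the bound on [F] makes [F] vanish
    there too. *)
Let a t := F t / m t.

Lemma density_mul t : a t * m t = F t.
Proof.
rewrite /a; have [mt0|mt0] := eqVneq (m t) 0; last by rewrite divfK.
by have := Fm t; rewrite mt0 !mulr0 normr_le0 => /eqP ->.
Qed.

Lemma density_bound t : 0 <= k -> `|a t| <= k.
Proof.
move=> k0; have [mt0|mt0] := eqVneq (m t) 0; first by rewrite /a mt0 invr0 mulr0 normr0.
have mp : 0 < m t by rewrite lt_neqAle eq_sym mt0 m0.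
by rewrite /a normrM normfV (gtr0_norm mp) ler_pdivrMr.
Qed.

(** Since [a t * m t = F t], this is the square of the L^2 norm of the martingale at depth [n]. *)
Let E n := \sum_(t <- words n) a t * F t.

(* Orthogonality of martingale differences. *)
Lemma energy_diff i j : (i <= j)%N ->
  \sum_(t <- words j) (a t - a (take i t)) ^+ 2 * m t = E j - E i.
Proof.
move=> ij.
rewrite (eq_bigr (fun t => a t * F t + (a (take i t) ^+ 2 * m t - 2 * a (take i t) * F t))); last first.
  by move=> t _; rewrite -[F t]density_mul; ring.
rewrite big_split sumrB /=.
rewrite (sum_words_take (fun t => a t ^+ 2) mD ij).
rewrite (sum_words_take (fun t => 2 * a t) FD ij).
congr (_ + _); rewrite -sumrB -sumrN; apply: eq_bigr => t _.
by rewrite -[F t]density_mul; ring.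
Qed.

Lemma energy_cauchy e : 0 < e -> 0 <= k -> exists N, forall i j,
  (N <= i)%N -> (i <= j)%N ->
  \sum_(t <- words j) `|a t - a (take i t)| * m t <= e.
Proof.
move=> e0 k0.
have Eincr i j : (i <= j)%N -> E i <= E j.
  move=> ij; rewrite -subr_ge0 -energy_diff//.
  by apply: sumr_ge0 => t _; rewrite mulr_ge0// sqr_ge0.
have Ecv : cvgn E.
  apply: nondecreasing_is_cvgn; first by move=> i j; exact: Eincr.
  exists (k * k * m [::]) => _ [n _ <-].
  rewrite -(sum_words_additive n mD) mulr_sumr; apply: ler_sum => t _.
  rewrite (le_trans (ler_norm _))// normrM -mulrA ler_pM//.
  exact: density_bound.
(* [h] balances the two halves of the estimate: the linear part is at most h m([::]) <= e / 2, and
   the quadratic part asks for an energy gap of at most e h / 2. The added 1 covers total mass 0. *)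
pose V := m [::] + 1.
have V0 : 0 < V by rewrite ltr_wpDl.
pose h := e / (2 * V).
have h0 : 0 < h by rewrite divr_gt0// mulr_gt0.
have eh0 : 0 < e * h / 2 by rewrite divr_gt0// mulr_gt0.
have /cvgrPdist_lt/(_ _ eh0)[N _ NP] := Ecv.
exists N => i j Ni ij.
have Nj := leq_trans Ni ij.
have Eij : E j - E i <= e * h / 2.
  have El : E j <= limn E by apply: nondecreasing_cvgn_le.
  have := NP i Ni; rewrite ger0_norm ?subr_ge0; last exact: nondecreasing_cvgn_le.
  by move=> /ltW; apply: le_trans; rewrite lerD2r.
(* AM-GM: [|u| <= h + u ^ 2 / h] *)
apply: (@le_trans _ _ (\sum_(t <- words j) (h * m t + h^-1 * ((a t - a (take i t)) ^+ 2 * m t)))).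
  apply: ler_sum => t _; rewrite mulrA -mulrDl ler_wpM2r//.
  rewrite -real_normK ?num_real//; move: `|_| => w.
  have h_neq0 : h != 0 by rewrite gt_eqF.
  rewrite -subr_ge0 (_ : _ - w = ((h - w / 2) ^+ 2 + 3 / 4 * w ^+ 2) / h); last by field.
  apply: divr_ge0; last exact: ltW.
  by apply: addr_ge0; [exact: sqr_ge0|apply: mulr_ge0; [lra|exact: sqr_ge0]].
rewrite big_split /= -!mulr_sumr (sum_words_additive _ mD) energy_diff//.
have -> : e = e / 2 + e / 2 by rewrite -splitr.
apply: lerD.
  have V_neq0 : V != 0 by rewrite gt_eqF.
  have -> : e / 2 = h * V by rewrite /h; field.
  by rewrite ler_pM2l// lerDl.
rewrite mulrC ler_pdivrMr//; apply: le_trans Eij _.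
by rewrite mulrAC.
Qed.

End tree_energy.

Section tree_uniformly_integrable.
Variables (R : realType) (m F : seq bool -> R) (Fk : nat -> seq bool -> R).
Variable tau : nat -> R.
Hypotheses (mD : tree_additive m) (m0 : forall t, 0 <= m t).
Hypothesis FkD : forall k, tree_additive (Fk k).
Hypothesis Fkm : forall k t, `|Fk k t| <= k%:R * m t.
Hypothesis Ftau : forall n k, \sum_(t <- words n) `|F t - Fk k t| <= tau k.
Hypothesis tau0 : tau k @[k --> \oo] --> 0.

Let small e : 0 < e -> exists k, tau k <= e.
Proof.
move=> e0; have /cvgrPdist_lt/(_ _ e0)[N _ /(_ N (leqnn N))] := tau0.
by rewrite /= sub0r normrN => /ltW h; exists N; exact: le_trans (ler_norm _) h.
Qed.

(** On a cell of measure 0 every [Fk k] vanishes, and [F] is within [tau k] of it for all [k]. *)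
Lemma tree_density_mul t : F t / m t * m t = F t.
Proof.
have [mt0|mt0] := eqVneq (m t) 0; last by rewrite divfK.
rewrite mt0 mulr0; apply/eqP; rewrite eq_sym -normr_le0.
apply/ler_addgt0Pr => e e0; rewrite add0r.
have [k ke] := small e0; apply: le_trans ke; apply: le_trans (Ftau (size t) k).
have := Fkm k t; rewrite mt0 mulr0 normr_le0 => /eqP Fk0.
apply: le_trans (ler_term_words (f := fun t => `|F t - Fk k t|) t _) => //=.
by rewrite Fk0 subr0.
Qed.

(** The error made at the ancestors of depth [i], summed over their descendants of depth [j], is by
    the tower property the error at depth [i]. So [tau k] bounds it as well as the error at depth
    [j], and the last third of [e] is left for the bounded martingale. *)
Lemma tree_density_cauchy e : 0 < e -> exists N, forall i j,
  (N <= i)%N -> (i <= j)%N ->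
  \sum_(t <- words j) `|F t / m t - F (take i t) / m (take i t)| * m t <= e.
Proof.
move=> e0; have [k ke] := small (divr_gt0 e0 (ltr0n R 3)).
have [N NP] := energy_cauchy mD (FkD k) (Fkm k) m0 (divr_gt0 e0 (ltr0n R 3)) (ler0n _ _).
exists N => i j Ni ij.
pose a t := F t / m t; pose b t := Fk k t / m t.
have ab t : `|a t - b t| * m t = `|F t - Fk k t|.
  rewrite -[X in _ * X]ger0_norm// -normrM mulrBl tree_density_mul.
  by rewrite (density_mul (Fkm k)).
apply: (@le_trans _ _ (\sum_(t <- words j) (`|F t - Fk k t| +
    `|b t - b (take i t)| * m t + `|a (take i t) - b (take i t)| * m t))).
  apply: ler_sum => t _; rewrite -ab -!mulrDl ler_wpM2r//.
  rewrite -/(a t) -/(a (take i t)) [X in _ <= _ + X]distrC.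
  rewrite (_ : a t - a (take i t) = (a t - b t) + (b t - b (take i t)) + (b (take i t) - a (take i t))); last by ring.
  by rewrite (le_trans (ler_normD _ _))// lerD2r ler_normD.
rewrite !big_split /= (sum_words_take (fun t => `|a t - b t|) mD ij).
under [X in _ + X]eq_bigr do rewrite ab.
have -> : e = e / 3 + e / 3 + e / 3 by field.
apply: lerD; last exact: le_trans (Ftau _ _) ke.
by apply: lerD; [exact: le_trans (Ftau _ _) ke|exact: NP].
Qed.

End tree_uniformly_integrable.

(** Uniform integrability stands in for the absolute continuity of the Radon-Nikodym theorem, since
    [F] is a function on words and not yet a measure. The integral of the limit over a cell can be
    computed at any sufficiently large depth. *)
Lemma tree_density d (T : measurableType d) (R : realType)
    (mu : {measure set T -> \bar R}) (D : set T) (B : nat -> set T)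
    (F : seq bool -> R) (Fk : nat -> seq bool -> R) (tau : nat -> R) :
  measurable D -> (forall j, measurable (B j)) -> (mu D < +oo)%E ->
  let m t := fine (mu (cell D B t)) in
  tree_additive F -> (forall k, tree_additive (Fk k)) ->
  (forall k t, `|Fk k t| <= k%:R * m t) ->
  (forall n k, \sum_(t <- words n) `|F t - Fk k t| <= tau k) ->
  tau k @[k --> \oo] --> 0 ->
  exists (g : T -> R) (phi : nat -> nat),
    [/\ measurable_fun D g, mu.-integrable D (EFin \o g),
        {ae mu, forall x, D x ->
           F (code B (phi j) x) / m (code B (phi j) x) @[j --> \oo] --> g x} &
        forall t, \int[mu]_(x in cell D B t) g x = F t].
Proof.
move=> mD mB muD m FD FkD Fkm Ftau tau0.
have m0 t : 0 <= m t by rewrite fine_ge0.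
have mA : tree_additive m by exact: fine_cell_additive.
pose f n x := F (code B n x) / m (code B n x).
have [] := @L1_cauchy_cvg _ _ _ mu D f mD.
- move=> n; exact: (integrable_code mD mB muD (fun t => F t / m t) n mD).
- move=> e e0.
  have [N NP] := tree_density_cauchy mA m0 FkD Fkm Ftau tau0 e0.
  exists N => j i Ni ij; apply: le_trans (NP _ _ Ni ij).
  rewrite -(Rintegral_code mD mB muD (fun t => `|F t / m t - F (take i t) / m (take i t)|)).
  rewrite le_eqVlt; apply/orP; left; apply/eqP; apply: eq_Rintegral => x _.
  by rewrite /f take_code.
move=> g [phi [phij gm gae gE]]; exists g, phi; split => //.
  by have [] := gE D mD (@subset_refl _ _).
move=> t.
(* The martingale property: on a cell of depth at most [n] the integral of [f n] is already [F t],
   so the sequence of integrals is eventually constant. *)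
have ft n : (size t <= n)%N -> \int[mu]_(x in cell D B t) f n x = F t.
  move=> /subnK <-; move: (n - size t)%N => {n}k; elim: k t => [|k IH] t.
    rewrite add0n (Rintegral_code_cell mu mD mB (fun t => F t / m t))//.
    by rewrite take_size (tree_density_mul Fkm Ftau tau0).
  rewrite (Rintegral_cell_additive mD mB); last first.
    exact: (integrable_code mD mB muD (fun t => F t / m t)).
  by rewrite addSnnS (FD t) -!IH !size_rcons.
have [_ ] := gE _ (measurable_cell mD mB t) (@cell_sub _ _ _ _).
move=> /cvg_lim <- //; apply: lim_near_cst => //; exists (size t) => // j /= tj.
exact: ft (leq_trans tj (phij j)).
Qed.

(** * Metric balls, Vitali selection, finite covers and packings *)

Section metric_basics.
Context {R : realType} {X : metricType R}.
Implicit Types (x y z : X) (r : R).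

Lemma in_ballE x r y : ball x r y = (mdist x y < r) :> Prop.
Proof. by rewrite ballEmdist. Qed.

Lemma ball_sub x y r s : mdist x y + s <= r -> ball y s `<=` ball x r.
Proof.
move=> h z; rewrite !in_ballE => yz; apply: lt_le_trans h.
by rewrite (le_lt_trans (metric_triangle _ y _))// ltrD2l.
Qed.

Lemma ball_disj x y r s : r + s <= mdist x y -> ball x r `&` ball y s = set0.
Proof.
move=> h; rewrite -subset0 => z []; rewrite !in_ballE => xz yz /=.
have := metric_triangle x z y; rewrite (metric_sym z) leNgt => /negP; apply.
by rewrite (lt_le_trans _ h)// ltrD.
Qed.

Lemma open_ball_metric x r : open (ball x r).
Proof.
rewrite openE => y; rewrite in_ballE => xy.
apply/nbhs_ballP; exists (r - mdist x y); rewrite /= ?subr_gt0//.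
by apply: ball_sub; rewrite addrC subrK.
Qed.

Lemma open_gt x r : open [set y | r < mdist x y].
Proof.
rewrite openE => y /= xy.
apply/nbhs_ballP; exists (mdist x y - r); rewrite /= ?subr_gt0// => z.
rewrite in_ballE /= => yz; rewrite ltNge; apply/negP => xz.
have := metric_triangle x z y; rewrite leNgt => /negP; apply.
by rewrite (metric_sym z) -ltrBrDl (lt_le_trans yz)// lerD2l lerN2.
Qed.

Lemma setC_gt x r : ~` [set y | r < mdist x y] = [set y | mdist x y <= r].
Proof. by apply/seteqP; split => y /=; [move/negP; rewrite -leNgt|rewrite leNgt => /negP]. Qed.

Lemma closed_le_mdist x r : closed [set y | mdist x y <= r].
Proof. by rewrite -setC_gt closedC; exact: open_gt. Qed.

(** Greedy selection: keep a point of largest radius, discard all points too close to it, and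
    continue with the rest. Each discarded point is close to a kept one whose radius is at least its
    own. *)
Lemma separated_sublist (r : X -> R) (l : seq X) :
  (forall x, x \in l -> 0 < r x) ->
  exists s : seq X, [/\ uniq s, {subset s <= l},
    forall x y, x \in s -> y \in s -> x != y -> r x + r y <= mdist x y &
    forall y, y \in l -> exists2 x, x \in s & r y <= r x /\ mdist x y < r x + r y].
Proof.
have [n] := ubnP (size l); elim: n l => // n IH [|a l] ln r0.
  by exists [::]; split.
have [x xl xmax] : exists2 x, x \in a :: l & forall y, y \in a :: l -> r y <= r x.
  elim: (l) a {ln r0} => [|b l' IHl] a.
    by exists a => [|y]; rewrite inE// => /eqP ->.
  have [x xl xm] := IHl b; have [ax|xa] := leP (r a) (r x).
    exists x => [|y]; rewrite inE ?xl ?orbT// => /predU1P[->//|]; exact: xm.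
  exists a => [|y]; rewrite inE ?eqxx// => /predU1P[->//|/xm h].
  exact: le_trans h (ltW xa).
have rx := r0 _ xl.
pose l' := [seq y <- a :: l | r x + r y <= mdist x y].
have l'l y : y \in l' -> (r x + r y <= mdist x y) && (y \in a :: l) by rewrite mem_filter.
(* The selected [x] is discarded too, being at distance 0 from itself, so the list gets shorter. *)
have sl' : (size l' < n)%N.
  have : (size (a :: l) <= n)%N by [].
  apply: leq_trans.
  rewrite size_filter -(count_predC (fun y => r x + r y <= mdist x y) (a :: l)).
  rewrite -[ltnLHS]addn0 ltn_add2l.
  rewrite -has_count; apply/hasP; exists x => //=.
  by rewrite mdistxx -ltNge addr_gt0.
have [|s [us sl ssep scov]] := IH l' sl'.
  by move=> y /l'l/andP[_ /r0].
have xs y : y \in s -> r x + r y <= mdist x y by move=> /sl/l'l/andP[].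
exists (x :: s); split.
- rewrite /= us andbT; apply/negP => /xs; rewrite mdistxx leNgt addr_gt0//.
- by move=> y; rewrite inE => /predU1P[->//|/sl/l'l/andP[]].
- move=> y z; rewrite !inE => /predU1P[->|ys] /predU1P[->|zs].
  + by rewrite eqxx.
  + by move=> _; exact: xs.
  + by move=> _; rewrite metric_sym addrC; exact: xs.
  + exact: ssep.
- move=> y yl; have [h|h] := leP (r x + r y) (mdist x y).
    have /scov[z zs hz] : y \in l' by rewrite mem_filter h.
    by exists z => //; rewrite inE zs orbT.
  by exists x; [rewrite inE eqxx|split => //; exact: xmax].
Qed.

End metric_basics.

(* The separation of centers replaces disjointness of balls, because unlike
   the latter it passes to nearby spaces. *)
Lemma vitali_finite (R : realType) (X : pmetricType R) (r : X -> R) (K : set X) :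
  compact K -> (forall x, K x -> 0 < r x) ->
  exists s : seq X, [/\ uniq s, forall x, x \in s -> K x,
    forall x y, x \in s -> y \in s -> x != y -> r x + r y <= mdist x y &
    forall y, K y -> exists2 x, x \in s & ball x (3 * r x) y].
Proof.
rewrite compact_cover => cK r0.
have [|z Kz|D DK Dcov] := cK X K (fun x => ball x (r x)).
- by move=> x _; exact: open_ball_metric.
- by exists z => //; rewrite in_ballE mdistxx r0.
have [|s [us sD ssep scov]] := @separated_sublist _ _ r (finmap.enum_fset D).
  by move=> x xD; apply: r0; have := DK x xD; rewrite inE.
exists s; split => //.
  by move=> x /sD xD; have := DK x xD; rewrite inE.
move=> y /Dcov[z zD]; rewrite in_ballE => zy.
have [x xs [rzx xz]] := scov z zD.
exists x => //; rewrite in_ballE (le_lt_trans (metric_triangle _ z _))//.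
rewrite (_ : 3 * r x = r x + r x + r x); last by ring.
by rewrite ltrD// ?(lt_le_trans xz)// ?(lt_le_trans zy) ?lerD2l.
Qed.

Lemma subset_measure d (T : measurableType d) (R : realType)
    (mu : {measure set T -> \bar R}) (A B : set T) :
  measurable A -> measurable B -> A `<=` B -> (mu A <= mu B)%E.
Proof. by move=> mA mB AB; apply: le_measure; rewrite ?inE. Qed.

Section measure_lists.
Context d (T : measurableType d) (R : realType) (mu : {measure set T -> \bar R}).
Variables (I : eqType) (F : I -> set T).

Lemma measure_le_cover (s : seq I) (K : set T) : measurable K ->
  (forall x, x \in s -> measurable (F x)) ->
  (forall y, K y -> exists2 x, x \in s & F x y) ->
  (mu K <= \sum_(x <- s) mu (F x))%E.
Proof.
elim: s K => [|a s IH] K mK mF KF.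
  rewrite big_nil (_ : K = set0) ?measure0// -subset0 => y /KF[x].
  by rewrite in_nil.
have mFa : measurable (F a) by apply: mF; rewrite mem_head.
rewrite big_cons (measureDI mu mK mFa) addeC leeD//.
  exact: measureIr.
apply: IH; first exact: measurableD.
  by move=> x xs; apply: mF; rewrite inE xs orbT.
move=> y [/KF[x]]; rewrite inE => /predU1P[->//|xs] Fxy _.
by exists x.
Qed.

(** [A'] is a part of [A] left free by the packed sets, so that a separate lower bound for it can be
    added to theirs. *)
Lemma measure_ge_packing (s : seq I) (A A' : set T) : uniq s ->
  measurable A -> measurable A' -> A' `<=` A ->
  (forall x, x \in s -> [/\ measurable (F x), F x `<=` A & F x `&` A' = set0]) ->
  (forall x y, x \in s -> y \in s -> x != y -> F x `&` F y = set0) ->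
  (\sum_(x <- s) mu (F x) + mu A' <= mu A)%E.
Proof.
move=> us mA mA'; elim: s A mA us => [|a s IH] A mA /=.
  by move=> _ A'A _ _; rewrite big_nil add0e; exact: subset_measure.
move=> /andP[as_ us] A'A Fs Fd.
have [mFa FaA FaA'] := Fs a (mem_head _ _).
rewrite big_cons (measureDI mu mA mFa) -addeA addeC.
rewrite (_ : A `&` F a = F a); last exact/setIidPr.
rewrite leeD2r//; apply: IH => //; first exact: measurableD.
- by move=> y A'y; split; [exact: A'A|move=> Fay; have : set0 y by rewrite -FaA'].
- move=> x xs; have [|mFx FxA FxA'] := Fs x; first by rewrite inE xs orbT.
  split => // y Fxy; split; [exact: FxA|move=> Fay].
  have : set0 y by rewrite -(Fd x a) ?inE ?xs ?eqxx ?orbT//; apply: contraNneq as_ => <-.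
  by [].
- by move=> x y xs ys; apply: Fd; rewrite inE (xs,ys) orbT.
Qed.

End measure_lists.

(** * Doubling measures and spheres *)

Section spheres.
Context {R : realType} (X : pmetricType R) (mu : {measure set (borel X) -> \bar R}).

Lemma open_borel (U : set X) : open U -> measurable (U : set (borel X)).
Proof. by move=> oU; apply: sub_sigma_algebra. Qed.

Lemma closed_borel (U : set X) : closed U -> measurable (U : set (borel X)).
Proof. by move=> /closed_openC/open_borel/measurableC; rewrite setCK. Qed.

Lemma ball_borel (x : X) r : measurable (ball x r : set (borel X)).
Proof. by apply: open_borel; exact: open_ball_metric. Qed.

Lemma cball_borel (x : X) r : measurable ([set y | mdist x y <= r] : set (borel X)).
Proof. by apply: closed_borel; exact: closed_le_mdist. Qed.

Lemma gt_borel (x : X) r : measurable ([set y | r < mdist x y] : set (borel X)).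
Proof. by apply: open_borel; exact: open_gt. Qed.

Definition doubling_below (C r0 : R) := forall (z : X) (r : R), 0 < r -> r < r0 ->
  (mu (ball z (2 * r)) <= C%:E * mu (ball z r))%E.

Lemma doubling_below3 (C r0 : R) z r : 0 <= C -> doubling_below C r0 -> 0 < r ->
  4 * r < r0 -> (mu (ball z (8 * r)) <= (C ^+ 3)%:E * mu (ball z r))%E.
Proof.
move=> C0 dbl r_gt0 rr0.
have -> : 8 * r = 2 * (2 * (2 * r)) by ring.
rewrite !exprS expr0 mulr1 !EFinM -!muleA.
have lemulC (a b : \bar R) : (a <= b -> C%:E * a <= C%:E * b)%E.
  by move=> ab; rewrite lee_wpmul2l.
apply: (le_trans (dbl z _ _ _)); [lra|lra|apply: (lemulC)].
apply: (le_trans (dbl z _ _ _)); [lra|lra|apply: (lemulC)].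
by apply: dbl; lra.
Qed.

Lemma sphere_borel (x : X) r : measurable ([set y | mdist x y = r] : set (borel X)).
Proof.
rewrite (_ : [set _ | _] = [set y | mdist x y <= r] `\` ball x r).
  by apply: measurableD; [exact: cball_borel|exact: ball_borel].
apply/seteqP; split => y /=.
  by move=> h; split; rewrite ?in_ballE h ?ltxx.
by rewrite in_ballE => -[xy /negP]; rewrite -leNgt => yx; apply/eqP; rewrite eq_le xy yx.
Qed.

Hypothesis mu_ball : forall x r, (mu (ball x r) < +oo)%E.

Lemma mu_bounded_fin (x : X) r (A : set (borel X)) : measurable A -> A `<=` ball x r ->
  mu A \is a fin_num.
Proof.
move=> mA AB; rewrite ge0_fin_numE//; apply: le_lt_trans (mu_ball x r).
by apply: subset_measure => //; exact: ball_borel.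
Qed.

Lemma ball_fin_num (x : X) r : mu (ball x r) \is a fin_num.
Proof. by rewrite ge0_fin_numE. Qed.

(* Moving from a point of the sphere halfway towards the center produces a
   comparable ball inside a thin annulus, so the measure of the sphere is at
   most a constant times that of arbitrarily thin annuli. *)
Lemma sphere_null (C r0 : R) (x : X) (r : R) :
  proper_space X -> geodesic_space X -> 0 <= C -> 0 < r0 ->
  doubling_below C r0 -> 0 < r -> mu [set y | mdist x y = r] = 0%E.
Proof.
move=> pX gX C0 r00 dbl r_gt0; set S := [set y | _].
have cS : compact S.
  apply: (subclosed_compact _ (pX x r)); last by move=> y /= ->.
  rewrite (_ : S = [set y | mdist x y <= r] `&` ~` (ball x r)).
    apply: closedI; first exact: closed_le_mdist.
    by apply: open_closedC; exact: open_ball_metric.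
  apply/seteqP; split => y /=.
    by move=> h; split; rewrite ?in_ballE h ?ltxx.
  by rewrite in_ballE => -[xy /negP]; rewrite -leNgt => yx; apply/eqP; rewrite eq_le xy yx.
pose A n := [set y | r - n.+1%:R^-1 < mdist x y] `&` ball x r.
have mA n : measurable (A n : set (borel X)).
  by apply: measurableI; [exact: gt_borel|exact: ball_borel].
have SA n : n.+1%:R^-1 < r -> n.+1%:R^-1 < r0 / 2 -> (mu S <= (C ^+ 3)%:E * mu (A n))%E.
  set e := n.+1%:R^-1 => er er0.
  have e0 : 0 < e by rewrite invr_gt0.
  have [s [us sS ssep scov]] := @vitali_finite _ _ (fun=> e) S cS (fun _ _ => e0).
  have /choice[q qP] : forall y, exists z, S y -> mdist y z = e / 2 /\ mdist x z = r - e / 2.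
    move=> y; have [Sy|] := pselect (S y); last by exists y.
    have [gam [g0 g1 gD]] := gX y x; have yx : mdist y x = r by rewrite metric_sym.
    exists (gam (e / 2)) => _; rewrite yx in gD g1.
    rewrite -{1}g0 -g1 (metric_sym (gam r)) !gD; try lra.
    split; [rewrite sub0r normrN gtr0_norm//; lra|].
    by rewrite ler0_norm; lra.
  apply: (@le_trans _ _ (\sum_(y <- s) mu (ball y (3 * e)))%E).
    apply: measure_le_cover => //; first exact: sphere_borel.
    by move=> y _; exact: ball_borel.
  (* [q y] is at distance e / 2 from [y], hence the ball of radius 3e around [y] lies in the one of
     radius 8 (e / 2) around [q y], three doublings away from radius e / 2. *)
  apply: (@le_trans _ _ (\sum_(y <- s) (C ^+ 3)%:E * mu (ball (q y) (e / 2)))%E).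
    rewrite !big_seq; apply: lee_sum => y /sS/qP[yq xq].
    apply: le_trans (doubling_below3 _ _ dbl _ _) => //; [|lra|lra].
    apply: subset_measure; [exact: ball_borel..|].
    by apply: ball_sub; rewrite metric_sym yq; lra.
  have qA y : S y -> ball (q y) (e / 2) `<=` (A n : set X).
    move=> /qP[yq xq] z; rewrite in_ballE => qz; split; rewrite ?in_ballE /=.
      have := metric_triangle x z (q y); rewrite (metric_sym z) -/e; lra.
    have := metric_triangle x (q y) z; lra.
  rewrite -ge0_sume_distrr; last by [].
  apply: lee_wpmul2l; first by rewrite lee_fin exprn_ge0.
  rewrite -[leLHS]adde0 -[X in (_ + X)%E](measure0 mu).
  apply: (@measure_ge_packing _ _ _ mu _ (fun y => ball (q y) (e / 2))) => //.
    by move=> y /sS/qA yA; split; [exact: ball_borel|exact: yA|rewrite setI0].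
  (* The centers are 2e apart and each is moved by e / 2, so the new centers are still e apart. *)
  move=> y z ys zs yz; have [yq _] := qP _ (sS _ ys); have [zq _] := qP _ (sS _ zs).
  apply: ball_disj; have := ssep _ _ ys zs yz.
  have := metric_triangle y (q y) z; have := metric_triangle (q y) (q z) z.
  rewrite (metric_sym (q z)); lra.
have A0 : mu (A n) @[n --> \oo] --> 0%E.
  have capA : \bigcap_n A n = set0.
    rewrite -subset0 => y yA /=; have [_] := yA 0%N I.
    rewrite in_ballE -subr_gt0 => ry.
    have [n _ /(_ n (leqnn n)) /= nr] := near_infty_natSinv_lt (PosNum ry).
    have [/= rn _] := yA n I.
    by move: nr; rewrite ltrBrDl -ltrBrDr => /(lt_trans rn); rewrite ltxx.
  suff : mu (A n) @[n --> \oo] --> mu (\bigcap_n A n) by rewrite capA measure0.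
  apply: nonincreasing_cvg_mu => //.
  - by rewrite -ge0_fin_numE//; apply: (@mu_bounded_fin x r) => // y [].
  - by rewrite capA.
  - move=> m n mn; apply/subsetPset => y [/= h ?]; split => //=.
    by apply: le_lt_trans h; rewrite lerD2l lerN2 lef_pV2 ?posrE// ler_nat.
apply/eqP; rewrite eq_le measure_ge0 andbT.
have : ((C ^+ 3)%:E * mu (A n))%E @[n --> \oo] --> ((C ^+ 3)%:E * 0)%E by apply: cvgeZl.
rewrite mule0; apply: cvge_ge.
have r02 : 0 < r0 / 2 by rewrite divr_gt0.
near=> n; apply: SA.
- by near: n; exact: (near_infty_natSinv_lt (PosNum r_gt0)).
- by near: n; exact: (near_infty_natSinv_lt (PosNum r02)).
Unshelve. all: by end_near. Qed.

End spheres.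

Lemma near_seq (T : Type) (F : set_system T) (FF : Filter F) (I : eqType) (s : seq I)
    (P : I -> T -> Prop) :
  (forall a, a \in s -> \forall i \near F, P a i) ->
  \forall i \near F, forall a, a \in s -> P a i.
Proof.
elim: s => [|a s IH] h; first by apply: filterE => i a; rewrite in_nil.
have h1 := h a (mem_head _ _).
have h2 := IH (fun b bs => h b (@mem_behead _ (a :: s) _ bs)).
by apply: filterS2 h1 h2 => i Pa Ps b; rewrite inE => /predU1P[->|/Ps].
Qed.

Lemma open_forall_seq (T : topologicalType) (I : eqType) (s : seq I) (P : I -> set T) :
  (forall a, a \in s -> open (P a)) -> open [set z | forall a, a \in s -> P a z].
Proof.
move=> oP; rewrite openE => z Pz; apply: near_seq => a as_.
by have := oP a as_; rewrite openE; apply; exact: Pz.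
Qed.

Lemma measurable_forall_seq d (T : measurableType d) (I : eqType) (s : seq I)
    (P : I -> set T) : (forall a, a \in s -> measurable (P a)) ->
  measurable [set z | forall a, a \in s -> P a z].
Proof.
elim: s => [|a s IH] mP.
  by rewrite (_ : [set _ | _] = setT)//; apply/seteqP; split.
rewrite (_ : [set _ | _] = P a `&` [set z | forall a, a \in s -> P a z]).
  by apply: measurableI; [apply: mP; rewrite mem_head|apply: IH => b bs; apply: mP; rewrite inE bs orbT].
apply/seteqP; split => z /=.
  by move=> h; split => [|b bs]; apply: h; rewrite inE ?eqxx ?bs ?orbT.
by move=> [Pa Ps] b; rewrite inE => /predU1P[->|/Ps].
Qed.

Lemma cvg_sum_seq (R : realType) (I : Type) (s : seq I) (f : I -> nat -> R) (l : I -> R) :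
  (forall a, f a i @[i --> \oo] --> l a) ->
  \sum_(a <- s) f a i @[i --> \oo] --> \sum_(a <- s) l a.
Proof.
move=> fl; elim: s => [|a s IH].
  by under eq_fun do rewrite big_nil; rewrite big_nil; exact: cvg_cst.
by under eq_fun do rewrite big_cons; rewrite big_cons; apply: cvgD.
Qed.

(** * Lower semicontinuity of measures and convergence of cells *)

Section pmGH.
Context {R : realType} (X : nat -> pmetricType R) (Xoo : pmetricType R).
Variables (x : forall i, X i) (xoo : Xoo).
Variables (rad : nat -> R) (psi : forall i, X i -> Xoo).
Variables (mu : forall i, {measure set (borel (X i)) -> \bar R})
  (muoo : {measure set (borel Xoo) -> \bar R}) (eps : nat -> R).
Hypothesis H : pmGH_cvg x xoo rad psi mu muoo eps.

Local Notation cvgp := (cvg_point x rad psi).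

Lemma near_ball_rad (w : Xoo) : \forall i \near \oo, ball xoo (rad i) w.
Proof.
have /cvgryPgt/(_ (mdist xoo w)) := pmGH_rad H.
by apply: filterS => i; rewrite in_ballE.
Qed.

Lemma ex_cvg_point (w : Xoo) : exists y, cvgp y w.
Proof.
have hy : forall i, exists y : X i, ball xoo (rad i) w ->
    ball (x i) (rad i) y /\ mdist w (psi y) < eps i.
  move=> i; have [wi|] := pselect (ball xoo (rad i) w); last by exists (x i).
  by have [y yx wy] := pmGH_dense H wi; exists y.
pose y i := projT1 (cid (hy i)); have yP i := projT2 (cid (hy i)).
exists y; split.
  by apply: filterS (near_ball_rad w) => i /yP[].
apply/metricType_numDomainType.cvgrPdist_lt => e e0.
have /cvgrPdist_lt/(_ _ e0) := pmGH_eps H.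
apply: filterS2 (near_ball_rad w) => i /yP[_ wy]; rewrite sub0r normrN => ee.
by rewrite (lt_trans wy)// (le_lt_trans (ler_norm _)).
Qed.

(** Each [psi i] distorts distances by less than [eps i]. Strict inequalities between distances in
    the limit space therefore hold in [X i] for large i, which is how inclusions and disjointness of
    balls are transferred. *)
Lemma cvg_point_dist y yoo z zoo : cvgp y yoo -> cvgp z zoo ->
  mdist (y i) (z i) @[i --> \oo] --> mdist yoo zoo.
Proof.
move=> [yb yc] [zb zc]; apply/cvgrPdist_lt => e e0.
have e3 : 0 < e / 3 by rewrite divr_gt0.
have /metricType_numDomainType.cvgrPdist_lt/(_ _ e3) y3 := yc.
have /metricType_numDomainType.cvgrPdist_lt/(_ _ e3) z3 := zc.
have /cvgrPdist_lt/(_ _ e3) eps3 := pmGH_eps H.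
near=> i.
have yi : mdist yoo (psi (y i)) < e / 3 by near: i.
have zi : mdist zoo (psi (z i)) < e / 3 by near: i.
have epsi : eps i < e / 3.
  have : `|0 - eps i| < e / 3 by near: i.
  by rewrite sub0r normrN; exact: le_lt_trans (ler_norm _).
have : `|mdist (y i) (z i) - mdist (psi (y i)) (psi (z i))| < eps i.
  by apply: (pmGH_dist H); near: i.
have := metric_triangle yoo (psi (y i)) zoo.
have := metric_triangle (psi (y i)) (psi (z i)) zoo.
have := metric_triangle (psi (y i)) yoo (psi (z i)).
have := metric_triangle yoo zoo (psi (z i)).
rewrite (metric_sym (psi (z i)) zoo) (metric_sym (psi (y i)) yoo).
rewrite !ltr_norml => *; apply/andP; split; lra.
Unshelve. all: by end_near. Qed.

Lemma near_dist_lt y yoo z zoo a : cvgp y yoo -> cvgp z zoo ->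
  mdist yoo zoo < a -> \forall i \near \oo, mdist (y i) (z i) < a.
Proof. by move=> yc zc; apply: cvgr_lt; exact: cvg_point_dist. Qed.

Lemma near_dist_gt y yoo z zoo a : cvgp y yoo -> cvgp z zoo ->
  a < mdist yoo zoo -> \forall i \near \oo, a < mdist (y i) (z i).
Proof. by move=> yc zc; apply: cvgr_gt; exact: cvg_point_dist. Qed.

(** An interior of the lower limit of the sets [A i]. Asking for one radius along all approximating
    sequences makes it open and avoids images and preimages under [psi]. *)
Definition inner_limit (A : forall i, set (X i)) : set Xoo :=
  [set w | exists2 r : R, 0 < r &
    forall y, cvgp y w -> \forall i \near \oo, ball (y i) r `<=` A i].

Lemma inner_limit_open A : open (inner_limit A).
Proof.
rewrite openE => w [r r0 wr].
apply/nbhs_ballP; exists (r / 2); rewrite /= ?divr_gt0// => w'.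
rewrite in_ballE => ww'; exists (r / 2); first by rewrite divr_gt0.
move=> y' y'w; have [y yw] := ex_cvg_point w.
apply: filterS2 (wr y yw) (near_dist_lt yw y'w ww') => i yA yy'.
by apply: subset_trans yA; apply: ball_sub; lra.
Qed.

Lemma inner_limit_ball c coo r : cvgp c coo ->
  ball coo r `<=` inner_limit (fun i => ball (c i) r).
Proof.
move=> cc w; rewrite in_ballE => wr.
exists ((r - mdist coo w) / 2); first by rewrite divr_gt0// subr_gt0.
move=> y yw; have h : mdist coo w < (r + mdist coo w) / 2 by lra.
apply: filterS (near_dist_lt cc yw h) => i ci.
by apply: ball_sub; lra.
Qed.

Lemma inner_limit_ballC c coo r : cvgp c coo ->
  [set w | r < mdist coo w] `<=` inner_limit (fun i => ~` ball (c i) r).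
Proof.
move=> cc w /= wr.
exists ((mdist coo w - r) / 2); first by rewrite divr_gt0// subr_gt0.
move=> y yw; have h : (r + mdist coo w) / 2 < mdist coo w by lra.
apply: filterS (near_dist_gt cc yw h) => i ci.
by apply/disjoints_subset; rewrite setIC; apply: ball_disj; lra.
Qed.

Lemma inner_limitI A B :
  inner_limit A `&` inner_limit B `<=` inner_limit (fun i => A i `&` B i).
Proof.
move=> w [[r r0 rA] [s s0 sB]]; exists (Num.min r s); first by rewrite lt_min r0.
move=> y yw; apply: filterS2 (rA y yw) (sB y yw) => i yA yB z.
by rewrite in_ballE lt_min => /andP[zr zs]; split; [apply: yA|apply: yB]; rewrite in_ballE.
Qed.

Lemma subset_inner_limit A B : (forall i, A i `<=` B i) ->
  inner_limit A `<=` inner_limit B.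
Proof.
move=> AB w [r r0 rA]; exists r => // y /rA; apply: filterS => i.
by move=> yA; exact: subset_trans yA (AB i).
Qed.

Lemma inner_limit_seq (I : eqType) (s : seq I) (A : I -> forall i, set (X i)) w :
  (forall a, a \in s -> inner_limit (A a) w) ->
  inner_limit (fun i => [set z | forall a, a \in s -> A a i z]) w.
Proof.
elim: s => [|a s IH] h.
  by exists 1 => // y _; apply: nearW => i z _ a; rewrite in_nil.
have : inner_limit (fun i => A a i `&` [set z | forall a, a \in s -> A a i z]) w.
  apply: inner_limitI; split; first by apply: h; rewrite mem_head.
  by apply: IH => b bs; apply: h; rewrite inE bs orbT.
move=> [r r0 rA]; exists r => // y /rA; apply: filterS => i + z zr => /(_ z zr)[Aa As] b.
by rewrite inE => /predU1P[->|/As].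
Qed.

End pmGH.

Section pmGH_lsc.
Context {R : realType} (X : nat -> pmetricType R) (Xoo : pmetricType R).
Variables (x : forall i, X i) (xoo : Xoo).
Variables (rad : nat -> R) (psi : forall i, X i -> Xoo).
Variables (mu : forall i, {measure set (borel (X i)) -> \bar R})
  (muoo : {measure set (borel Xoo) -> \bar R}) (eps : nat -> R).
Hypothesis H : pmGH_cvg x xoo rad psi mu muoo eps.
Hypothesis mu_ball : forall i y r, (mu i (ball y r) < +oo)%E.
Hypothesis muoo_ball : forall y r, (muoo (ball y r) < +oo)%E.
Hypothesis muoo_reg : forall U : set Xoo, open U ->
  muoo U = ereal_sup [set muoo K | K in [set K : set Xoo | compact K /\ K `<=` U]].
Hypothesis muoo_sphere : forall (y : Xoo) r, 0 < r -> muoo [set z | mdist y z = r] = 0%E.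
Variables (C r0 : R).
Hypotheses (C0 : 0 <= C) (r0_gt0 : 0 < r0) (dbl : doubling_below muoo C r0).

Local Notation cvgp := (cvg_point x rad psi).
Local Notation inner_limit := (inner_limit x rad psi).

Lemma fine_ball_cvg y yoo r : 0 < r -> cvgp y yoo ->
  fine (mu i (ball (y i) r)) @[i --> \oo] --> fine (muoo (ball yoo r)).
Proof.
move=> r_gt0 yc; apply: fine_cvg; rewrite fineK; first exact: pmGH_meas H _ _ _ r_gt0 yc.
exact: ball_fin_num.
Qed.

Lemma ex_half_compact (U : set Xoo) M : open U -> U `<=` ball xoo M ->
  exists K : set Xoo, [/\ compact K, K `<=` U & (muoo U <= 2%:E * muoo K)%E].
Proof.
move=> oU UM; have [U0|U0] := eqVneq (muoo U) 0%E.
  by exists set0; split; [exact: compact0|exact: sub0set|rewrite U0 measure0 mule0].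
have Ufin : muoo U \is a fin_num.
  by apply: (mu_bounded_fin muoo_ball) UM; exact: open_borel.
have Up : 0 < fine (muoo U) by rewrite fine_gt0// lt0e U0 measure_ge0 /= -ge0_fin_numE.
have : ((fine (muoo U) / 2)%:E < muoo U)%E by rewrite -[ltRHS]fineK// lte_fin; lra.
rewrite [ltRHS]muoo_reg// => /ereal_sup_gt[_ [K [cK KU] <-]] UK.
exists K; split => //; rewrite -[leLHS]fineK//.
rewrite (_ : fine (muoo U) = 2 * (fine (muoo U) / 2)); last by field.
by rewrite EFinM lee_wpmul2l// ltW.
Qed.

(** The factor 2 pays for a compact subset with half the mass, and [C ^+ 3] for comparing the balls
    of radius 3r of a Vitali cover with those of radius r / 2. *)
Let K0 := 2 * C ^+ 3.

(** Lower semicontinuity with a fraction [t] of the mass given away: trivial for t = 1, the goal for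
    t = 0. [M] keeps [U] bounded, hence of finite measure. *)
Let lower t M := forall (A : forall i, set (X i)) (U : set Xoo) e,
  (forall i, measurable (A i : set (borel (X i)))) ->
  open U -> U `<=` inner_limit A -> U `<=` ball xoo M -> 0 < e ->
  \forall i \near \oo, (((1 - t) * fine (muoo U) - e)%:E <= mu i (A i))%E.

(* A Vitali family of balls in U lifts to disjoint balls in [A i]; they carry
   a fixed fraction of the mass of U, and the induction hypothesis applies to
   what remains. *)
Lemma lower_step t M : 0 <= t -> t <= 1 -> lower t M -> lower (t * (K0 / (K0 + 1))) M.
Proof.
move=> t0 t1 IH A U e mA oU UA UM e0.
have r04 : 0 < r0 / 4 by rewrite divr_gt0.
have r042 : r0 / 4 < r0 / 2 by rewrite ltr_pM2l// ltf_pV2 ?posrE// ltr_nat.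
have K00 : 0 <= K0 by rewrite mulr_ge0// exprn_ge0.
have [K [cK KU UK]] := ex_half_compact oU UM.
(* Radii below r0 / 2 leave room for three doublings starting at r / 2; outside [K] the value is a
   dummy. *)
have /choice[r rP] : forall y : Xoo, exists r : R, [/\ 0 < r, r < r0 / 2 &
    K y -> ball y r `<=` U /\
    forall z, cvgp z y -> \forall i \near \oo, ball (z i) r `<=` A i].
  move=> y; have [Ky|nKy] := pselect (K y); last first.
    by exists (r0 / 4); split.
  have [r r_gt0 rA] := UA _ (KU _ Ky).
  have /nbhs_ballP[s /= s_gt0 sU] : nbhs y U by apply: open_nbhs_nbhs; split => //; exact: KU.
  exists (Num.min (Num.min r s) (r0 / 4)); split.
  - by rewrite !lt_min r_gt0 s_gt0.
  - by rewrite gt_min r042 orbT.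
  - move=> _; split.
      by move=> z; rewrite in_ballE !lt_min => /andP[/andP[_ ?] _]; apply: sU; rewrite in_ballE.
    move=> z /rA; apply: filterS => i + w; rewrite in_ballE !lt_min => zA /andP[/andP[? _] _].
    by apply: zA; rewrite in_ballE.
have r_gt0 y : 0 < r y by have [] := rP y.
have r_r0 y : r y < r0 / 2 by have [] := rP y.
have [s [us sK ssep scov]] := vitali_finite cK (fun y _ => r_gt0 y).
pose L (y : Xoo) := projT1 (cid (ex_cvg_point H y)).
have Lc y : cvgp (L y) y by exact: projT2 (cid (ex_cvg_point H y)).
(* Radii are halved: centers at distance at least r y + r z are strictly farther apart than the sum
   of the halves, and strict inequalities pass to [X i]. *)
pose b (y : Xoo) := ball y (r y / 2).
pose S := \sum_(y <- s) fine (muoo (b y)).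
have bE y : muoo (b y) = (fine (muoo (b y)))%:E.
  by rewrite fineK//; exact: ball_fin_num.
have Ufin : muoo U \is a fin_num by apply: (mu_bounded_fin muoo_ball) UM; exact: open_borel.
have US : fine (muoo U) <= K0 * S.
  rewrite -lee_fin fineK// (le_trans UK)// /K0 -mulrA EFinM lee_wpmul2l//.
  apply: (@le_trans _ _ (\sum_(y <- s) muoo (ball y (3 * r y)))%E).
    apply: measure_le_cover => //; last by move=> y _; exact: ball_borel.
    by apply: closed_borel; apply: compact_closed => //; exact: metric_hausdorff.
  rewrite /S mulr_sumr -sumEFin; apply: lee_sum => y _.
  rewrite EFinM -bE; have ry2 : 0 < r y / 2 by rewrite divr_gt0.
  apply: le_trans (doubling_below3 _ C0 dbl ry2 _); last by have := r_r0 y; lra.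
  apply: subset_measure; [exact: ball_borel..|].
  by apply: ball_sub; rewrite mdistxx; have := r_gt0 y; lra.
(* Closed balls are removed from [U], which keeps [U'] open, but open balls from [A i]. The spheres
   in between are null, so [U] loses at most the mass [S]. *)
pose U' := U `&` [set z | forall y, y \in s -> r y / 2 < mdist y z].
pose A' i := A i `&` [set z | forall y, y \in s -> (~` ball (L y i) (r y / 2)) z].
have oU' : open U'.
  by apply: openI => //; apply: open_forall_seq => y _; exact: open_gt.
have mA' i : measurable (A' i : set (borel (X i))).
  apply: measurableI => //; apply: measurable_forall_seq => y _.
  by apply: measurableC; exact: ball_borel.
have U'A' : U' `<=` inner_limit A'.
  move=> w [/UA wA ws]; apply: inner_limitI; split => //.
  by apply: inner_limit_seq => y ys; apply: (inner_limit_ballC H (Lc y)); exact: ws.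
have U'M : U' `<=` ball xoo M by move=> z [/UM].
have UU' : fine (muoo U) <= fine (muoo U') + S.
  have U'fin : muoo U' \is a fin_num by apply: (mu_bounded_fin muoo_ball) U'M; exact: open_borel.
  rewrite -lee_fin EFinD !fineK// (measureDI muoo (open_borel oU) (open_borel oU')) addeC.
  apply: leeD; last by apply: measureIr; exact: open_borel.
  have h1 : (muoo (U `\` U') <= \sum_(y <- s) muoo [set z | (mdist y z <= r y / 2)%R])%E.
    apply: measure_le_cover; first by apply: measurableD; exact: open_borel.
      by move=> y _; exact: cball_borel.
    move=> z [Uz nU'z]; apply: contrapT => h; apply: nU'z; split => // y ys.
    by rewrite ltNge; apply/negP => yz; apply: h; exists y.
  apply: (le_trans h1); rewrite /S -sumEFin.
  apply: lee_sum => y _; rewrite -bE -[leRHS]adde0 -(muoo_sphere y (divr_gt0 (r_gt0 y) (ltr0n R 2))).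
  apply: le_trans (measureU2 _ (ball_borel _ _) (sphere_borel _ _)).
  apply: subset_measure; first exact: cball_borel.
    by apply: measurableU; [exact: ball_borel|exact: sphere_borel].
  move=> z /=; rewrite le_eqVlt => /predU1P[->|]; [by right|by left; rewrite in_ballE].
have e2 : 0 < e / 2 by rewrite divr_gt0.
have N1 := IH A' U' (e / 2) mA' oU' U'A' U'M e2.
pose Si i := \sum_(y <- s) fine (mu i (ball (L y i) (r y / 2))).
have N2 : \forall i \near \oo, S - e / 2 < Si i.
  have : Si i @[i --> \oo] --> S.
    by apply: cvg_sum_seq => y; apply: fine_ball_cvg; rewrite ?divr_gt0.
  by move=> SiS; apply: (cvgr_gt _ SiS); rewrite ltrBlDr ltrDl.
have N3 : \forall i \near \oo, forall y, y \in s -> ball (L y i) (r y / 2) `<=` A i.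
  apply: near_seq => y /sK Ky; have [_ _ /(_ Ky)[_ /(_ _ (Lc y))]] := rP y.
  apply: filterS => i; apply: subset_trans; apply: ball_sub.
  by rewrite mdistxx; have := r_gt0 y; lra.
have N4 : \forall i \near \oo, forall y, y \in s -> forall z, z \in s -> y != z ->
    ball (L y i) (r y / 2) `&` ball (L z i) (r z / 2) = set0.
  apply: near_seq => y ys; apply: near_seq => z zs.
  have [->|yz] := eqVneq y z; first by apply: nearW.
  have h : r y / 2 + r z / 2 < mdist y z.
    by have := ssep _ _ ys zs yz; have := r_gt0 y; have := r_gt0 z; lra.
  apply: filterS (near_dist_gt H (Lc y) (Lc z) h) => i /ltW yzi _.
  exact: ball_disj.
near=> i.
have N3i : forall y, y \in s -> ball (L y i) (r y / 2) `<=` A i by near: i.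
have N4i : forall y, y \in s -> forall z, z \in s -> y != z ->
    ball (L y i) (r y / 2) `&` ball (L z i) (r z / 2) = set0 by near: i.
have A'A : (\sum_(y <- s) mu i (ball (L y i) (r y / 2)) + mu i (A' i) <= mu i (A i))%E.
  apply: measure_ge_packing => //.
  - by move=> z [].
  - move=> y ys; split; [exact: ball_borel|exact: N3i|].
    by rewrite -subset0 => z [zy [_ /(_ y ys)]].
  - by move=> y z ys zs; exact: N4i.
apply: le_trans A'A.
have -> : (\sum_(y <- s) mu i (ball (L y i) (r y / 2)))%E = (Si i)%:E.
  rewrite /Si -sumEFin; apply: eq_bigr => y _; rewrite fineK//.
  exact/ball_fin_num/mu_ball.
have N1i : (((1 - t) * fine (muoo U') - e / 2)%:E <= mu i (A' i))%E by near: i.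
have N2i : S - e / 2 < Si i by near: i.
apply: le_trans (leeD2l _ N1i); rewrite -EFinD lee_fin.
(* Let u be the mass of [U]. Packed balls and remainder give at least S + (1 - t)(u - S) = (1 - t) u
   + t S up to e, and S >= u / (K0 + 1), where the added 1 avoids dividing by 0. *)
have h1 : (1 - t) * fine (muoo U) <= (1 - t) * (fine (muoo U') + S).
  by rewrite ler_wpM2l// subr_ge0.
have h2 : t * (fine (muoo U) / (K0 + 1)) <= t * S.
  rewrite ler_wpM2l// ler_pdivrMr; last by lra.
  have : 0 <= S by apply: sumr_ge0 => y _; rewrite fine_ge0.
  by rewrite mulrDr mulr1 mulrC; lra.
have h3 : (1 - t * (K0 / (K0 + 1))) * fine (muoo U) =
   (1 - t) * fine (muoo U) + t * (fine (muoo U) / (K0 + 1)).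
  have K1 : K0 + 1 != 0 by rewrite gt_eqF; lra.
  by field.
rewrite h3; lra.
Unshelve. all: by end_near. Qed.

(** Each round multiplies the fraction given away by the same factor k < 1, so finitely many rounds,
    starting from the trivial t = 1, bring the loss below e / 2. *)
Lemma measure_lsc (A : forall i, set (X i)) (U : set Xoo) M e :
  (forall i, measurable (A i : set (borel (X i)))) ->
  open U -> U `<=` inner_limit A -> U `<=` ball xoo M -> 0 < e ->
  \forall i \near \oo, ((fine (muoo U) - e)%:E <= mu i (A i))%E.
Proof.
move=> mA oU UA UM e0; pose k := K0 / (K0 + 1).
have K00 : 0 <= K0 by rewrite mulr_ge0// exprn_ge0.
have k0 : 0 <= k by rewrite divr_ge0// addr_ge0.
have k1 : k < 1 by rewrite ltr_pdivrMr ?ltr_wpDl// mul1r ltrDl.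
have low n : lower (k ^+ n) M.
  elim: n => [|n IH]; last first.
    by rewrite exprSr; apply: lower_step => //; [exact: exprn_ge0|rewrite exprn_ile1// ltW].
  move=> A' U' e' _ _ _ _ e'0; apply: nearW => i.
  by rewrite expr0 subrr mul0r sub0r (le_trans _ (measure_ge0 _ _))// lee_fin oppr_le0 ltW.
have e2 : 0 < e / 2 by rewrite divr_gt0.
have U0 : 0 <= fine (muoo U) by rewrite fine_ge0.
have kn : k ^+ n * fine (muoo U) @[n --> \oo] --> 0 * fine (muoo U).
  by apply: cvgMl; apply: cvg_expr; rewrite ger0_norm.
rewrite mul0r in kn.
have /cvgrPdist_lt/(_ _ e2)[n _ /(_ n (leqnn n))] := kn.
rewrite /= sub0r normrN ger0_norm ?mulr_ge0 ?exprn_ge0// => kne.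
apply: filterS (low n A U (e / 2) mA oU UA UM e2) => i; apply: le_trans.
rewrite lee_fin mulrBl mul1r; lra.
Qed.

Section cells.
Variables (rho : R) (c : nat -> forall i, X i) (coo : nat -> Xoo) (q : nat -> R).
Hypotheses (rho0 : 0 < rho) (cc : forall j, cvgp (c j) (coo j)) (q0 : forall j, 0 < q j).

Definition ball_cell i t : set (X i) := cell (ball (x i) rho) (fun j => ball (c j i) (q j)) t.
Definition ball_celloo t : set Xoo := cell (ball xoo rho) (fun j => ball (coo j) (q j)) t.

Lemma ball_cell_borel i t : measurable (@ball_cell i t : set (borel (X i))).
Proof. by apply: measurable_cell => [|j]; exact: ball_borel. Qed.

Lemma ball_celloo_borel t : measurable (ball_celloo t : set (borel Xoo)).
Proof. by apply: measurable_cell => [|j]; exact: ball_borel. Qed.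

(** A point of the limit cell that lies on none of the spheres satisfies each membership or
    non-membership strictly, so with a margin also in [X i]. What remains lies on finitely many null
    spheres. *)
Lemma ball_celloo_boundary t :
  muoo (ball_celloo t `\` inner_limit (fun i => @ball_cell i t)) = 0%E.
Proof.
have mI A : measurable (inner_limit A : set (borel Xoo)).
  by apply: open_borel; exact: (inner_limit_open H).
elim/last_ind: t => [|t b IH].
  rewrite (_ : _ `\` _ = set0) ?measure0//; apply/disjoints_subset; rewrite setCK.
  rewrite /ball_celloo cell_nil => w /(inner_limit_ball H (pmGH_base H)).
  by apply: subset_inner_limit => i; rewrite /ball_cell cell_nil.
set j := size t; pose S := [set z | mdist (coo j) z = q j].
have sub : ball_celloo (rcons t b) `\` inner_limit (fun i => @ball_cell i (rcons t b)) `<=`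
    (ball_celloo t `\` inner_limit (fun i => @ball_cell i t)) `|` S.
  move=> w [wt nwt]; have [jw|jw] := eqVneq (mdist (coo j) w) (q j); first by right.
  left; move: wt; rewrite /ball_celloo cell_rcons => -[wt wb]; split => // wI; apply: nwt.
  have : inner_limit (fun i => @ball_cell i t `&`
      (if b then ball (c j i) (q j) else ~` ball (c j i) (q j))) w; last first.
    by apply: subset_inner_limit => i; rewrite /ball_cell cell_rcons.
  apply: inner_limitI; split => //.
  case: b wb => wb; first exact: (inner_limit_ball H (cc j)).
  have nwb : ~ (mdist (coo j) w < q j) by rewrite -in_ballE.
  apply: (inner_limit_ballC H (cc j)) => /=.
  by rewrite lt_neqAle eq_sym jw leNgt; apply/negP.
apply/eqP; rewrite eq_le measure_ge0 andbT.
have mB u : measurable (ball_celloo u `\` inner_limit (fun i => @ball_cell i u) : set (borel Xoo)).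
  by apply: measurableD => //; exact: ball_celloo_borel.
have mS : measurable (S : set (borel Xoo)) by exact: sphere_borel.
apply: le_trans (@subset_measure _ _ _ muoo _ _ (mB _) (measurableU _ _ (mB t) mS) sub) _.
have e0 : (muoo (ball_celloo t `\` inner_limit (fun i => @ball_cell i t)) + muoo S = 0)%E.
  by rewrite IH muoo_sphere// adde0.
by apply: (le_trans (measureU2 muoo (mB t) mS)); rewrite -[leRHS]e0.
Qed.

Lemma ball_cell_lower t e : 0 < e ->
  \forall i \near \oo, fine (muoo (ball_celloo t)) - e <= fine (mu i (@ball_cell i t)).
Proof.
move=> e0; set I := inner_limit (fun i => @ball_cell i t).
have oI : open I by exact: (inner_limit_open H).
have oU : open (I `&` ball xoo rho) by apply: openI => //; exact: open_ball_metric.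
have UI : I `&` ball xoo rho `<=` I by move=> z [].
have UB : I `&` ball xoo rho `<=` ball xoo rho by move=> z [].
have := measure_lsc (fun i => @ball_cell_borel i t) oU UI UB e0.
apply: filterS => i; rewrite -lee_fin fineK; last first.
  by apply: (mu_bounded_fin (@mu_ball i) (@ball_cell_borel i t)); exact: cell_sub.
apply: le_trans; rewrite lee_fin lerD2r.
apply: fine_le.
- by apply: (mu_bounded_fin muoo_ball (ball_celloo_borel t)); exact: cell_sub.
- by apply: (mu_bounded_fin muoo_ball) UB; exact: open_borel.
rewrite (measureDI muoo (ball_celloo_borel t) (open_borel oI)).
rewrite [X in (X + _)%E](_ : _ = 0%E) ?add0e; last exact: ball_celloo_boundary.
apply: subset_measure.
- by apply: measurableI; [exact: ball_celloo_borel|exact: open_borel].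
- exact: open_borel.
- by move=> z [zt zI]; split => //; exact: cell_sub zt.
Qed.

(** The two children of a cell add up to it. Given convergence for the parent, the lower bound for
    either child is an upper bound for the other. *)
Lemma ball_cell_cvg t :
  fine (mu i (@ball_cell i t)) @[i --> \oo] --> fine (muoo (ball_celloo t)).
Proof.
pose f i t := fine (mu i (@ball_cell i t)); pose foo t := fine (muoo (ball_celloo t)).
have fD i : tree_additive (f i).
  apply: fine_cell_additive => [|j|]; [exact: ball_borel..|exact: mu_ball].
have fooD : tree_additive foo.
  apply: fine_cell_additive => [|j|]; [exact: ball_borel..|exact: muoo_ball].
elim/last_ind: t => [|t b IH].
  rewrite /ball_cell /ball_celloo cell_nil; under eq_fun do rewrite cell_nil.
  by apply: fine_ball_cvg => //; exact: pmGH_base H.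
apply/cvgrPdist_le => e e0; have e2 : 0 < e / 2 by rewrite divr_gt0.
have /cvgrPdist_le/(_ _ e2) IHe := IH.
have Lb := @ball_cell_lower (rcons t b) _ e2.
have Lnb := @ball_cell_lower (rcons t (~~ b)) _ e2.
near=> i.
have h1 : `|foo t - f i t| <= e / 2 by near: i.
have h2 : foo (rcons t b) - e / 2 <= f i (rcons t b) by near: i.
have h3 : foo (rcons t (~~ b)) - e / 2 <= f i (rcons t (~~ b)) by near: i.
rewrite -/(foo _) -/(f i _); have := fD i t; have := fooD t.
move: h1 h2 h3; rewrite !ler_norml => /andP[]; case: (b) => /= *; apply/andP; split; lra.
Unshelve. all: by end_near. Qed.

End cells.
End pmGH_lsc.

(** * Truncation and integrals over subsets *)

(** Large values are sent to 0 and not clipped. At level 0 nothing survives, so the truncation error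
    there is the full L^1 norm. *)
Definition trunc (R : realDomainType) (k t : R) : R := if `|t| <= k then t else 0.

Lemma norm_trunc (R : realDomainType) (k t : R) : 0 <= k -> `|trunc k t| <= k.
Proof. by rewrite /trunc; case: ifP => // _ k0; rewrite normr0. Qed.

Lemma norm_trunc_le (R : realDomainType) (k t : R) : `|trunc k t| <= `|t|.
Proof. by rewrite /trunc; case: ifP => // _; rewrite normr0. Qed.

Lemma integrable_cst d (T : measurableType d) (R : realType)
    (mu : {measure set T -> \bar R}) (E : set T) (k : R) :
  measurable E -> (mu E < +oo)%E -> mu.-integrable E (EFin \o cst k).
Proof.
move=> mE muE; apply: measurable_bounded_integrable => //.
by exists `|k|; split; [exact: num_real|move=> M Mk y _; exact: ltW].
Qed.

Section Rintegral_subset.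
Context d (T : measurableType d) (R : realType) (mu : {measure set T -> \bar R}).
Variables (A E : set T) (f : T -> R).
Hypotheses (mA : measurable A) (mE : measurable E) (EA : E `<=` A).
Hypothesis fi : mu.-integrable A (EFin \o f).

Lemma Rintegral_setD : \int[mu]_(y in A `\` E) f y =
  \int[mu]_(y in A) f y - \int[mu]_(y in E) f y.
Proof.
have AE : A = E `|` (A `\` E) by rewrite setDUK.
rewrite [in X in _ = X - _]AE Rintegral_setU//.
- by rewrite addrC addKr.
- exact: measurableD.
- by rewrite -AE.
- by apply/eqP; rewrite -subset0 => y [Ey [_]].
Qed.

Lemma ge0_subset_Rintegral : (forall y, A y -> 0 <= f y) ->
  \int[mu]_(y in E) f y <= \int[mu]_(y in A) f y.
Proof.
move=> f0; rewrite -subr_ge0 -Rintegral_setD; apply: Rintegral_ge0 => y [Ay _].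
exact: f0.
Qed.

Lemma norm_Rintegral_setD :
  `|\int[mu]_(y in A) f y - \int[mu]_(y in E) f y| <=
  \int[mu]_(y in A `\` E) `|f y|.
Proof.
rewrite -Rintegral_setD; apply: le_normr_Rintegral; first exact: measurableD.
by apply: integrableS fi => //; exact: measurableD.
Qed.

End Rintegral_subset.

Section truncation.
Context d (T : measurableType d) (R : realType) (mu : {measure set T -> \bar R}).
Variables (D : set T) (f : T -> R).
Hypotheses (mD : measurable D) (muD : (mu D < +oo)%E).
Hypothesis fi : mu.-integrable D (EFin \o f).

Lemma measurable_trunc k : measurable_fun setT (@trunc R k).
Proof.
by apply: measurable_fun_ifT => //; exact: measurable_fun_ler.
Qed.

Lemma integrable_trunc k : mu.-integrable D (EFin \o (trunc k \o f)).
Proof.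
apply: (le_integrable mD _ _ fi).
  apply/measurable_EFinP; apply: measurableT_comp (measurable_trunc k) _.
  exact/measurable_EFinP/(measurable_int mu fi).
by move=> t _; rewrite /= lee_fin norm_trunc_le.
Qed.

Lemma integrable_sub_trunc k :
  mu.-integrable D (EFin \o (fun y => f y - trunc k (f y))).
Proof.
have := integrableB mD fi (integrable_trunc k).
by apply: eq_integrable.
Qed.

(** Uniform integrability in quantitative form: a large [k] makes the first term small, then a small
    measure of [E] the second, uniformly over functions with a common truncation bound. *)
Lemma Rintegral_norm_le_trunc k E : 0 <= k -> measurable E -> E `<=` D ->
  \int[mu]_(y in E) `|f y| <=
    \int[mu]_(y in D) `|f y - trunc k (f y)| + k * fine (mu E).
Proof.
move=> k0 mE ED.
have muE : (mu E < +oo)%E by apply: le_lt_trans muD; exact: subset_measure.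
have fE : mu.-integrable E (EFin \o f) by apply: integrableS fi.
have dD := integrable_norm (integrable_sub_trunc k).
have dE : mu.-integrable E (EFin \o (fun y => `|f y - trunc k (f y)|)).
  by apply: integrableS dD.
have kE : mu.-integrable E (EFin \o cst k) by exact: integrable_cst.
apply: (@le_trans _ _ (\int[mu]_(y in E) (`|f y - trunc k (f y)| + k))).
  apply: le_Rintegral => //.
  - exact: integrable_norm.
  - by have := integrableD mE dE kE; apply: eq_integrable.
  - move=> y _; rewrite -{1}(subrK (trunc k (f y)) (f y)).
    by rewrite (le_trans (ler_normD _ _))// lerD2l norm_trunc.
rewrite RintegralD// Rintegral_cst// lerD2r.
rewrite /Rintegral fine_le//; [exact: integrable_fin_num|exact: integrable_fin_num|].
by apply: ge0_subset_integral => //; exact: (measurable_int mu dD).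
Qed.

Lemma Rintegral_trunc_le k E : 0 <= k -> measurable E -> E `<=` D ->
  `|\int[mu]_(y in E) trunc k (f y)| <= k * fine (mu E).
Proof.
move=> k0 mE ED.
have muE : (mu E < +oo)%E by apply: le_lt_trans muD; exact: subset_measure.
have tE : mu.-integrable E (EFin \o (trunc k \o f)).
  exact: integrableS (integrable_trunc k).
apply: (le_trans (le_normr_Rintegral mE tE)); rewrite -Rintegral_cst//.
apply: le_Rintegral => //; [exact: integrable_norm|exact: integrable_cst|].
by move=> y _; exact: norm_trunc.
Qed.

End truncation.

Lemma Rintegral_inner_ball_cvg (R : realType) (X : pmetricType R)
    (mu : {measure set (borel X) -> \bar R}) (z : X) r (f : X -> R) :
  mu.-integrable (ball z r : set (borel X)) (EFin \o f) ->
  \int[mu]_(y in ball z (r - n.+1%:R^-1)) f y @[n --> \oo] -->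
  \int[mu]_(y in ball z r) f y.
Proof.
move=> fi; pose B := ball z r.
have mB s : measurable (ball z s : set (borel X)) by exact: ball_borel.
have sB n : ball z (r - n.+1%:R^-1) `<=` B.
  by apply: ball_sub; rewrite mdistxx add0r gerBl.
have fm : measurable_fun (B : set (borel X)) (EFin \o f) by exact: measurable_int fi.
have [] := @dominated_convergence _ _ _ mu B (mB r)
  (fun n => (EFin \o f) \_ (ball z (r - n.+1%:R^-1))) (EFin \o f) (abse \o (EFin \o f)).
- move=> n; apply: (measurable_restrict _ (mB _) (mB _)).1.
  by apply: measurable_funS (mB r) _ fm; exact: subIsetl.
- exact: fm.
- apply: aeW => y; rewrite /B in_ballE => By; apply: cvg_near_cst.
  have ry : 0 < r - mdist z y by rewrite subr_gt0.
  have := near_infty_natSinv_lt (PosNum ry); apply: filterS => n /= nr.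
  by rewrite patchT// inE in_ballE ltrBrDr -ltrBrDl.
- exact: (integrable_abse fi).
- apply: aeW => y n _; rewrite /patch; case: ifP => // _.
  by rewrite (_ : point = 0%E) ?abse0 ?abse_ge0.
move=> _ _; under eq_fun do rewrite /= -integral_mkcondr.
have Bi := integrable_fin_num (mB r) fi.
move=> h; apply: fine_cvg; rewrite fineK//; move: h.
suff -> : (fun n => \int[mu]_(y in B `&` ball z (r - n.+1%:R^-1)) (EFin \o f) y)%E =
   (fun n => \int[mu]_(y in ball z (r - n.+1%:R^-1)) (EFin \o f) y)%E by [].
by apply/funext => n; congr (integral mu _ _); apply/setIidPr.
Qed.

Lemma average_fin (R : realType) (X : pmetricType R)
    (mu : {measure set (borel X) -> \bar R}) (f : X -> R) (A : set X) :
  measurable (A : set (borel X)) -> (0 < mu A)%E -> (mu A < +oo)%E ->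
  mu.-integrable (A : set (borel X)) (EFin \o f) ->
  average mu f A = ((\int[mu]_(y in A) f y) / fine (mu A))%:E.
Proof.
move=> mA A0 Aoo fi; rewrite /average.
have Afin : mu A \is a fin_num by rewrite ge0_fin_numE.
rewrite -[X in (X^-1)%E]fineK// inver gt_eqF ?fine_gt0 ?A0//.
rewrite -[X in (_ * X)%E]fineK; last exact: integrable_fin_num fi.
by rewrite -EFinM mulrC.
Qed.

(** * Bounds in L^p *)

(** The left side is the tangent at [a] of the convex function t^r. The inequality is Young's for
    [t] and a^(r-1), with the conjugate exponents r and r / (r-1). *)
Lemma powR_tangent (R : realType) (a t r : R) : 0 <= a -> 0 <= t -> 1 < r ->
  r * a `^ (r - 1) * t - (r - 1) * a `^ r <= t `^ r.
Proof.
move=> a0 t0 r1; have r0 : 0 < r by rewrite (lt_trans ltr01).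
have r10 : 0 < r - 1 by rewrite subr_gt0.
have q0 : 0 < r / (r - 1) by rewrite divr_gt0.
have pq : r^-1 + (r / (r - 1))^-1 = 1.
  have r_neq0 : r != 0 by rewrite gt_eqF.
  have r1_neq0 : r - 1 != 0 by rewrite gt_eqF.
  by field; rewrite ?r_neq0 ?r1_neq0.
have := conjugate_powR t0 (powR_ge0 a (r - 1)) r0 q0 pq.
rewrite -powRrM (_ : (r - 1) * (r / (r - 1)) = r); last by rewrite mulrC divfK// gt_eqF.
rewrite -(ler_pM2l r0) mulrDr.
rewrite (_ : r * (t `^ r / r) = t `^ r); last by rewrite mulrC divfK// gt_eqF.
rewrite (_ : r * (a `^ r / (r / (r - 1))) = (r - 1) * a `^ r); last first.
  have r_neq0 : r != 0 by rewrite gt_eqF.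
  have r1_neq0 : r - 1 != 0 by rewrite gt_eqF.
  by field; rewrite ?r_neq0 ?r1_neq0.
by rewrite lerBlDr -mulrA [a `^ _ * t]mulrC.
Qed.

Lemma powR_tangent_eq (R : realType) (a r : R) : 0 <= a -> 1 < r ->
  r * a `^ (r - 1) * a - (r - 1) * a `^ r = a `^ r.
Proof.
move=> a0 r1; rewrite -mulrA -[X in _ * (_ * X)]powRr1// -powRD; last first.
  by rewrite subrK gt_eqF// (lt_trans ltr01).
by rewrite subrK; ring.
Qed.

Lemma norm_le_powR (R : realType) (t r : R) : 1 < r -> `|t| <= 1 + `|t| `^ r.
Proof.
move=> r1; have [t1|t1] := leP `|t| 1.
  by rewrite (le_trans t1)// lerDl powR_ge0.
rewrite (@le_trans _ _ (`|t| `^ r))// ?lerDr//.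
by rewrite -{1}[`|t|]powRr1// ler_powR// ltW.
Qed.

(** The difference is nonzero only where |t| > k, and there |t|^(r-1) >= k^(r-1). *)
Lemma norm_sub_trunc_powR (R : realType) (k t r : R) : 1 < r -> 0 < k ->
  `|t - trunc k t| <= `|t| `^ r / k `^ (r - 1).
Proof.
move=> r1 k0; rewrite /trunc; case: ifPn => [_|].
  by rewrite subrr normr0 divr_ge0// powR_ge0.
rewrite subr0 -ltNge => kt; have t0 := lt_trans k0 kt.
rewrite ler_pdivlMr ?powR_gt0//.
have -> : `|t| `^ r = `|t| * `|t| `^ (r - 1).
  rewrite -[X in _ = X * _]powRr1// -powRD; last by rewrite (gt_eqF t0) implybT.
  by rewrite addrC subrK.
rewrite ler_pM2l//; apply: ge0_ler_powR; rewrite ?nnegrE ?ltW//.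
by rewrite subr_gt0.
Qed.

Section Lp_finite.
Context d (T : measurableType d) (R : realType) (mu : {measure set T -> \bar R}).
Variables (D : set T) (f : T -> R) (r K : R).
Hypotheses (mD : measurable D) (muD : (mu D < +oo)%E) (r1 : 1 < r).
Hypothesis fm : measurable_fun D f.
Hypothesis fK : (\int[mu]_(y in D) (`|f y| `^ r)%:E <= K%:E)%E.

Lemma measurable_norm_powR : measurable_fun D (fun y => `|f y| `^ r).
Proof.
apply: (measurableT_comp (measurable_powR _)); exact: measurableT_comp.
Qed.

Lemma integrable_powR_Lp : mu.-integrable D (EFin \o (fun y => `|f y| `^ r)).
Proof.
apply/integrableP; split; first exact/measurable_EFinP/measurable_norm_powR.
under eq_integral do rewrite /= ger0_norm ?powR_ge0//.
by rewrite (le_lt_trans fK)// ltry.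
Qed.

Let Rpow : \int[mu]_(y in D) `|f y| `^ r <= K.
Proof.
by rewrite -lee_fin fineK//; exact: (integrable_fin_num mD integrable_powR_Lp).
Qed.

Let onei : mu.-integrable D (EFin \o (fun y => 1 + `|f y| `^ r)).
Proof.
have := integrableD mD (integrable_cst 1 mD muD) integrable_powR_Lp.
by apply: eq_integrable.
Qed.

Lemma integrable_Lp : mu.-integrable D (EFin \o f).
Proof.
apply: le_integrable onei => //; first exact/measurable_EFinP.
by move=> y _; rewrite /= lee_fin (le_trans (norm_le_powR _ r1))// ler_norm.
Qed.

Lemma Rintegral_Lp_le : \int[mu]_(y in D) `|f y| <= fine (mu D) + K.
Proof.
apply: (@le_trans _ _ (\int[mu]_(y in D) (1 + `|f y| `^ r))).
  apply: le_Rintegral => //; first exact: integrable_norm integrable_Lp.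
  by move=> y _; exact: norm_le_powR.
rewrite RintegralD//; [|exact: integrable_cst|exact: integrable_powR_Lp].
by rewrite Rintegral_cst// mul1r lerD2l.
Qed.

Lemma Rintegral_Lp_trunc k : 0 < k ->
  \int[mu]_(y in D) `|f y - trunc k (f y)| <= K / k `^ (r - 1).
Proof.
move=> k0; apply: (@le_trans _ _ (\int[mu]_(y in D) (`|f y| `^ r / k `^ (r - 1)))).
  apply: le_Rintegral => //.
  - exact: integrable_norm (integrable_sub_trunc mD integrable_Lp k).
  - have := integrableZr mD (k `^ (r - 1))^-1 integrable_powR_Lp.
    by apply: eq_integrable.
  - by move=> y _; exact: norm_sub_trunc_powR.
rewrite RintegralZr//; last exact: integrable_powR_Lp.
by rewrite ler_wpM2r// invr_ge0 powR_ge0.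
Qed.

(** Jensen's inequality in linearized form: for fixed [a] the left side is affine in the measure of
    [E] and in the absolute value of the integral, so it passes to the limit in i. *)
Lemma Rintegral_powR_tangent a E : 0 <= a -> measurable E -> E `<=` D ->
  r * a `^ (r - 1) * `|\int[mu]_(y in E) f y| - (r - 1) * a `^ r * fine (mu E) <=
  \int[mu]_(y in E) `|f y| `^ r.
Proof.
move=> a0 mE ED.
have muE : (mu E < +oo)%E by apply: le_lt_trans muD; exact: subset_measure.
have fE : mu.-integrable E (EFin \o f) by apply: integrableS integrable_Lp.
have pE : mu.-integrable E (EFin \o (fun y => `|f y| `^ r)).
  by apply: integrableS integrable_powR_Lp.
have nE := integrable_norm fE.
have lE : mu.-integrable E (EFin \o (fun y => r * a `^ (r - 1) * `|f y|)).
  have := integrableZl mE (r * a `^ (r - 1)) nE; by apply: eq_integrable.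
have cE := integrable_cst ((r - 1) * a `^ r) mE muE.
apply: (@le_trans _ _ (\int[mu]_(y in E) (r * a `^ (r - 1) * `|f y| - (r - 1) * a `^ r))).
  rewrite RintegralB// RintegralZl// Rintegral_cst// lerD2r.
  rewrite ler_wpM2l ?mulr_ge0 ?powR_ge0 ?(ltW (lt_trans ltr01 r1))//.
  exact: le_normr_Rintegral.
apply: le_Rintegral => //.
  by have := integrableB mE lE cE; apply: eq_integrable.
by move=> y _; exact: powR_tangent.
Qed.

End Lp_finite.

Section Lp_bounded.
Context d (T : measurableType d) (R : realType) (mu : {measure set T -> \bar R}).
Variables (D : set T) (f : T -> R) (M : R).
Hypotheses (mD : measurable D) (muD : (mu D < +oo)%E) (M0 : 0 <= M).
Hypothesis fm : measurable_fun D f.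
Hypothesis fM : {ae mu, forall y, D y -> `|f y| <= M}.

Let fMe E : E `<=` D -> measurable E ->
  (\int[mu]_(y in E) `|f y|%:E <= M%:E * mu E)%E.
Proof.
move=> ED mE; rewrite -(integral_cst _ mE); apply: ae_ge0_le_integral => //.
- by apply/measurable_EFinP/measurableT_comp => //; exact: measurable_funS fm.
- by apply: filterS fM => y yM Ey; rewrite lee_fin yM//; exact: ED.
Qed.

Lemma integrable_ae_bounded : mu.-integrable D (EFin \o f).
Proof.
apply/integrableP; split; first exact/measurable_EFinP.
apply: (le_lt_trans (fMe (@subset_refl _ _) mD)).
rewrite -[mu D]fineK ?ge0_fin_numE// -EFinM ltry//.
Qed.

Lemma Rintegral_ae_bounded E : measurable E -> E `<=` D ->
  \int[mu]_(y in E) `|f y| <= M * fine (mu E).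
Proof.
move=> mE ED.
have muE : (mu E < +oo)%E by apply: le_lt_trans muD; exact: subset_measure.
have fE : mu.-integrable E (EFin \o f) by apply: integrableS integrable_ae_bounded.
have muEfin : mu E \is a fin_num by rewrite ge0_fin_numE.
rewrite -lee_fin EFinM (fineK (integrable_fin_num mE (integrable_norm fE))) fineK//.
exact: fMe.
Qed.

Lemma Rintegral_ae_bounded_trunc k : M <= k ->
  \int[mu]_(y in D) `|f y - trunc k (f y)| = 0.
Proof.
move=> Mk; rewrite /Rintegral (ae_eq_integral (cst 0%E))//.
- by rewrite integral0.
- exact: (measurable_int mu (integrable_norm (integrable_sub_trunc mD integrable_ae_bounded k))).
- apply: filterS fM => y + Dy; move=> /(_ Dy) yM.
  by rewrite /trunc (le_trans yM Mk) subrr normr0.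
Qed.

End Lp_bounded.

Section Lp_spaces.
Context {R : realType} (X : pmetricType R) (mu : {measure set (borel X) -> \bar R}).
Variables (A : set X) (f : X -> R).
Hypothesis mA : measurable (A : set (borel X)).

Lemma in_Lp_measurable p : in_Lp mu p A f -> measurable_fun (A : set (borel X)) f.
Proof.
move=> /andP[+ _]; rewrite inE => fA.
by have := (@measurable_restrict _ _ (borel X) _ A setT f mA measurableT).2 fA; rewrite setTI.
Qed.

Lemma in_LpI p : measurable_fun (A : set (borel X)) f -> (Lp_norm mu p A f < +oo)%E ->
  in_Lp mu p A f.
Proof.
move=> fm fp; apply/andP; split; last by rewrite inE.
rewrite inE; apply: (@measurable_restrict _ _ (borel X) _ A setT f mA measurableT).1.
by rewrite setTI.
Qed.

Lemma Lp_norm_powR r : r != 0 ->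
  (Lp_norm mu r%:E A f `^ r = \int[mu]_(y in A) (`|f y| `^ r)%:E)%E.
Proof.
move=> r0; rewrite /Lp_norm poweR_Lnorm// [RHS]integral_mkcond.
apply: eq_integral => y _; rewrite /patch /= /patch.
by case: ifP => // _; rewrite normr0 powR0.
Qed.

Lemma in_Lp_powR r K : 0 < r -> measurable_fun (A : set (borel X)) f ->
  (\int[mu]_(y in A) (`|f y| `^ r)%:E <= K%:E)%E -> in_Lp mu r%:E A f.
Proof.
move=> r0 fm fK; apply: in_LpI => //.
have := Lp_norm_powR (lt0r_neq0 r0).
move=> E; rewrite ltNge leye_eq; apply/negP => /eqP Noo.
by move: fK; rewrite -E Noo poweRyr ?gt_eqF// leye_eq.
Qed.

Lemma Lp_norm_oo_ae M : (Lp_norm mu +oo A f <= M%:E)%E ->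
  {ae mu, forall y, A y -> `|f y| <= M}.
Proof.
rewrite /Lp_norm unlock; case: ifPn => [_ /ess_sup_inf.ess_supP|].
  by apply: filterS => y /= + Ay; rewrite patchT ?inE// lee_fin.
(* On a space of measure 0 the norm is 0 by convention, and every bound holds almost everywhere. *)
rewrite -leNgt => T0 _; exists setT; split => //.
by apply/eqP; rewrite eq_le T0 measure_ge0.
Qed.

Lemma in_Lp_oo M : 0 <= M -> measurable_fun (A : set (borel X)) f ->
  {ae mu, forall y, A y -> `|f y| <= M} -> in_Lp mu +oo A f.
Proof.
move=> M0 fm fM; apply: in_LpI => //; apply: (@le_lt_trans _ _ M%:E); last exact: ltry.
rewrite /Lp_norm unlock; case: ifPn => [_|_]; last by rewrite lee_fin.
have h : {ae mu, forall y, ((abse \o (EFin \o f \_ A)) y <= M%:E)%E}.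
  move: fM; apply: (filterS (Filter := ae_filter_ringOfSetsType mu)) => y yM; rewrite /= lee_fin /patch.
  by case: ifPn => [|_]; [rewrite inE => /yM|rewrite normr0].
exact/ess_sup_inf.ess_supP.
Qed.

End Lp_spaces.

Lemma limn_einf_ge_near (R : realType) (c : nat -> \bar R) (l : \bar R) :
  (\forall j \near \oo, (l <= c j)%E) -> (l <= limn_einf c)%E.
Proof.
move=> lc; have -> : limn_einf c = limf_einf c \oo by [].
rewrite limf_einfE; apply: (@le_trans _ _ (ereal_inf [set c j | j in [set j | (l <= c j)%E]])).
  by apply: le_ereal_inf_tmp => _ [j lj <-].
by apply: ereal_sup_ubound; exists [set j | (l <= c j)%E].
Qed.

Lemma limn_einf_le (R : realType) (c : nat -> \bar R) (l : \bar R) :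
  (forall j, (c j <= l)%E) -> (limn_einf c <= l)%E.
Proof.
move=> cl; have -> : limn_einf c = limf_einf c \oo by [].
rewrite limf_einfE; apply: ge_ereal_sup => _ [V [N _ NV] <-].
by apply: le_trans (cl N); apply: ereal_inf_lbound; exists N => //; apply: NV => /=.
Qed.

(** Fatou's lemma. Pointwise, the tangent at the limit value, evaluated along [u j], bounds the
    powers from below and converges to the power of the limit. *)
Lemma ae_cvg_powR_bound d (T : measurableType d) (R : realType)
    (mu : {measure set T -> \bar R}) (D : set T) (u : nat -> T -> R) (f : T -> R) r K :
  measurable D -> 1 < r -> (forall j, measurable_fun D (u j)) ->
  (forall j, \int[mu]_(y in D) (`|u j y| `^ r)%:E <= K%:E)%E ->
  measurable_fun D f ->
  {ae mu, forall y, D y -> u j y @[j --> \oo] --> f y} ->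
  (\int[mu]_(y in D) (`|f y| `^ r)%:E <= K%:E)%E.
Proof.
move=> mD r1 um uK fm uf.
have pm (h : T -> R) : measurable_fun D h -> measurable_fun D (fun y => (`|h y| `^ r)%:E).
  move=> hm; apply/measurable_EFinP.
  by apply: (measurableT_comp (measurable_powR _)); exact: measurableT_comp.
apply: (@le_trans _ _ (\int[mu]_(y in D) limn_einf (fun j => (`|u j y| `^ r)%:E))%E).
  apply: ae_ge0_le_integral => //.
  - exact: pm.
  - by move=> y _; apply: limn_einf_ge_near; apply: nearW => j; rewrite lee_fin powR_ge0.
  - apply: (measurableT_comp (@oppe_measurable R setT)).
    apply: measurable_fun_limn_esup => j; apply: measurableT_comp => //; exact: pm.
  - apply: filterS uf => y + Dy => /(_ Dy) uy; set a := `|f y|.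
    apply/lee_addgt0Pr => e e0; rewrite -leeBlDr//; apply: limn_einf_ge_near.
    have : r * a `^ (r - 1) * `|u j y| - (r - 1) * a `^ r @[j --> \oo] -->
        r * a `^ (r - 1) * a - (r - 1) * a `^ r.
      by apply: cvgB; [apply: cvgMr; exact: cvg_norm|exact: cvg_cst].
    have a0 : 0 <= a by exact: normr_ge0.
    rewrite (powR_tangent_eq a0 r1).
    move=> h; have : a `^ r - e < a `^ r by rewrite ltrBlDr ltrDl.
    move=> /(cvgr_gt _ h); apply: filterS => j /ltW aj; rewrite -EFinB lee_fin.
    by apply: (le_trans aj); apply: powR_tangent => //; exact: normr_ge0.
apply: (le_trans (fatou mu mD _ _)).
- by move=> j; exact: pm.
- by move=> j y _; rewrite lee_fin powR_ge0.
- exact: limn_einf_le.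
Qed.

(** * The weak limit *)

Section weak_limit.
Context {R : realType} (X : nat -> pmetricType R) (Xoo : pmetricType R).
Variables (x : forall i, X i) (xoo : Xoo).
Variables (rad : nat -> R) (psi : forall i, X i -> Xoo).
Variables (mu : forall i, {measure set (borel (X i)) -> \bar R})
  (muoo : {measure set (borel Xoo) -> \bar R}) (eps : nat -> R).
Hypothesis H : pmGH_cvg x xoo rad psi mu muoo eps.
Hypothesis mu_ball : forall i y r, (mu i (ball y r) < +oo)%E.
Hypothesis muoo_ball : forall y r, (muoo (ball y r) < +oo)%E.
Hypothesis muoo_pos : forall y r, 0 < r -> (0 < muoo (ball y r))%E.

Local Notation cvgp := (cvg_point x rad psi).

Variables (rho : R) (c : nat -> forall i, X i) (coo : nat -> Xoo) (q : nat -> R).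
Hypotheses (cc : forall j, cvgp (c j) (coo j)) (q0 : forall j, 0 < q j).
Hypothesis cq_dense : forall (w : Xoo) (s e : R), 0 < s -> 0 < e ->
  exists j, mdist w (coo j) < e /\ `|q j - s| < e.

Local Notation D i := (ball (x i) rho).
Local Notation Doo := (ball xoo rho).
Local Notation B i := (fun j => ball (c j i) (q j)).
Local Notation Boo := (fun j => ball (coo j) (q j)).
Local Notation cellX i t := (@ball_cell R X x rho c q i t).
Local Notation cellY t := (@ball_celloo R Xoo xoo rho coo q t).

Hypothesis cell_cvg : forall t,
  fine (mu i (cellX i t)) @[i --> \oo] --> fine (muoo (cellY t)).

Variables (g : forall i, X i -> R) (tau : nat -> R).
Hypothesis gi : forall i, (mu i).-integrable (D i : set (borel (X i))) (EFin \o @g i).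
Hypothesis g_tau : forall i k,
  \int[mu i]_(y in D i) `|g y - trunc k%:R (g y)| <= tau k.
Hypothesis tau0 : tau k @[k --> \oo] --> 0.

Variables (F : seq bool -> R) (Fk : nat -> seq bool -> R).
Hypothesis gF : forall t, \int[mu i]_(y in cellX i t) g y @[i --> \oo] --> F t.
Hypothesis gFk : forall k t,
  \int[mu i]_(y in cellX i t) trunc k%:R (g y) @[i --> \oo] --> Fk k t.

Let mD i : measurable (D i : set (borel (X i))). Proof. exact: ball_borel. Qed.
Let mB i j : measurable (B i j : set (borel (X i))). Proof. exact: ball_borel. Qed.
Let mDoo : measurable (Doo : set (borel Xoo)). Proof. exact: ball_borel. Qed.
Let mBoo j : measurable (Boo j : set (borel Xoo)). Proof. exact: ball_borel. Qed.

Lemma cvg_tree_additive (f : nat -> seq bool -> R) (l : seq bool -> R) :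
  (forall i, tree_additive (f i)) -> (forall t, f i t @[i --> \oo] --> l t) ->
  tree_additive l.
Proof.
move=> fD fl t.
apply: (cvg_unique _ (fl t)) => //.
rewrite (_ : (fun i => f i t) = (fun i => f i (rcons t true) + f i (rcons t false))).
  exact: cvgD.
by apply/funext => i; exact: fD.
Qed.

Let truncD i k : tree_additive (fun t => \int[mu i]_(y in cellX i t) trunc k%:R (g y)).
Proof.
apply: (Rintegral_cell_additive (@mD i) (@mB i) (f := fun y => trunc k%:R (g y))).
exact: (integrable_trunc (@mD i) (gi i)).
Qed.

(** At each i the integrals over cells are additive, those of the truncations are at most k times
    the measure, and the two differ in sum by at most [tau k]. Each relation involves finitely many
    cells, so it survives the limit. *)
Lemma weak_limit_density : exists (goo : Xoo -> R) (phi : nat -> nat),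
  [/\ measurable_fun (Doo : set (borel Xoo)) goo,
      muoo.-integrable (Doo : set (borel Xoo)) (EFin \o goo),
      {ae muoo, forall y, Doo y ->
        F (code Boo (phi j) y) / fine (muoo (cellY (code Boo (phi j) y)))
          @[j --> \oo] --> goo y} &
      forall t, \int[muoo]_(y in cellY t) goo y = F t].
Proof.
apply: (tree_density (T := borel Xoo) mDoo (@mBoo) _ (Fk := Fk) (tau := tau)) => //.
- apply: (cvg_tree_additive (f := fun i t => \int[mu i]_(y in cellX i t) g y)) => // i.
  exact: (Rintegral_cell_additive (@mD i) (@mB i)).
- move=> k; apply: (cvg_tree_additive (f := fun i t => \int[mu i]_(y in cellX i t) trunc k%:R (g y))).
    by move=> i; exact: truncD.
  exact: gFk.
- move=> k t; have kt : k%:R * fine (mu i (cellX i t)) @[i --> \oo] --> k%:R * fine (muoo (cellY t)).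
    by apply: cvgMr; exact: cell_cvg.
  apply: (ler_cvg_to (cvg_norm (@gFk k t)) kt).
  apply: nearW => i; apply: (Rintegral_trunc_le (@mD i) _ (gi i)) => //.
    exact: ball_cell_borel.
  exact: cell_sub.
- move=> n k; have : \sum_(t <- words n) `|\int[mu i]_(y in cellX i t) g y -
      \int[mu i]_(y in cellX i t) trunc k%:R (g y)| @[i --> \oo] -->
      \sum_(t <- words n) `|F t - Fk k t|.
    by apply: cvg_sum_seq => t; apply: cvg_norm; apply: cvgB.
  move=> h; apply: (ler_cvg_to h (cvg_cst (tau k))); apply: nearW => i.
  apply: le_trans (g_tau i k).
  have di := integrable_sub_trunc (@mD i) (gi i) k%:R.
  rewrite -(Rintegral_words (@mD i) (@mB i) n (integrable_norm di)).
  apply: ler_sum => t _.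
  have mt : measurable (cellX i t : set (borel (X i))) by exact: ball_cell_borel.
  have tD : cellX i t `<=` D i by exact: cell_sub.
  rewrite -RintegralB//.
  - by apply: le_normr_Rintegral => //; exact: integrableS di.
  - exact: integrableS (gi i).
  - by apply: integrableS (integrable_trunc (@mD i) (gi i) k%:R).
Qed.

Variable goo : Xoo -> R.
Hypothesis gooi : muoo.-integrable (Doo : set (borel Xoo)) (EFin \o goo).
Hypothesis gooF : forall t, \int[muoo]_(y in cellY t) goo y = F t.

Lemma Rintegral_base_ball_cvg j :
  \int[mu i]_(y in D i `&` B i j) g y @[i --> \oo] -->
  \int[muoo]_(y in Doo `&` Boo j) goo y.
Proof.
under eq_fun do rewrite (Rintegral_setI_cells j (@mD _) (@mB _) (gi _)).
rewrite (Rintegral_setI_cells j mDoo (@mBoo) gooi).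
by apply: cvg_sum_seq => t; rewrite gooF; exact: gF.
Qed.

(* Approximate [ball zoo r] from inside by one of the countably many reference
   balls; uniform integrability controls the difference along the sequence. *)
Lemma Rintegral_ball_cvg z zoo r : cvgp z zoo -> 0 < r -> mdist xoo zoo + r < rho ->
  \int[mu i]_(y in ball (z i) r) g y @[i --> \oo] -->
  \int[muoo]_(y in ball zoo r) goo y.
Proof.
move=> zc r0 zr.
have zD : ball zoo r `<=` Doo by apply: ball_sub; exact: ltW.
have gz : muoo.-integrable (ball zoo r : set (borel Xoo)) (EFin \o goo).
  exact: integrableS (ball_borel _ _) zD gooi.
apply/cvgrPdist_le => e e0.
have e6 : 0 < e / 6 by rewrite divr_gt0.
have [k tauk] : exists k, tau k <= e / 6.
  have /cvgrPdist_le/(_ _ e6)[k _ /(_ k (leqnn k))] := tau0.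
  rewrite /= sub0r normrN => h; exists k; exact: le_trans (ler_norm _) h.
(* In [X i] the ball and the reference ball will differ by a set of measure at most 3 dl. As k dl <=
   e / 6, this costs three sixths of e plus one for truncation; the other two go to the limit space
   and to the reference ball. *)
pose dl := e / 6 / k.+1%:R.
have dl0 : 0 < dl by rewrite divr_gt0.
have kdl : k%:R * dl <= e / 6.
  by rewrite /dl mulrCA ler_piMr ?(ltW e6)// ler_pdivrMr// mul1r ler_nat.
have gzn := integrable_norm gz.
have inner1 := Rintegral_inner_ball_cvg gzn.
have inner2 : fine (muoo (ball zoo (r - n.+1%:R^-1))) @[n --> \oo] --> fine (muoo (ball zoo r)).
  have one := integrable_cst 1 (ball_borel zoo r) (muoo_ball zoo r).
  have := Rintegral_inner_ball_cvg one; rewrite Rintegral_cst ?mul1r; last exact: ball_borel.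
  rewrite (_ : (fun n => _) = (fun n => fine (muoo (ball zoo (r - n.+1%:R^-1)))))//.
  by apply/funext => n; rewrite Rintegral_cst ?mul1r//; exact: ball_borel.
have [n [n1 n2 nr]] : exists n, [/\
    \int[muoo]_(y in ball zoo r) `|goo y| - \int[muoo]_(y in ball zoo (r - n.+1%:R^-1)) `|goo y| <= e / 6,
    fine (muoo (ball zoo r)) - fine (muoo (ball zoo (r - n.+1%:R^-1))) <= dl & n.+1%:R^-1 < r].
  have /cvgrPdist_le/(_ _ e6) h1 := inner1.
  have /cvgrPdist_le/(_ _ dl0) h2 := inner2.
  have h3 := near_infty_natSinv_lt (PosNum r0).
  near \oo => n; exists n; split.
  - by apply: le_trans (ler_norm _) _; near: n; exact: h1.
  - by apply: le_trans (ler_norm _) _; near: n; exact: h2.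
  - by near: n; exact: h3.
have h0 : 0 < n.+1%:R^-1 :> R by rewrite invr_gt0.
move: h0 n1 n2 nr; move: (n.+1%:R^-1) => h h0 n1 n2 nr.
(* Radius r - h / 2 and precision h / 4 squeeze the reference ball between the balls of radius r - h
   and r around [zoo]; the outer inclusion is strict enough to persist in [X i]. *)
have rh0 : 0 < r - h / 2 by lra.
have h40 : 0 < h / 4 by lra.
have [j [dj]] := cq_dense zoo rh0 h40.
rewrite ltr_norml => /andP[qj1 qj2].
have dq : mdist zoo (coo j) < r - q j by lra.
have Bz : ball (coo j) (q j) `<=` ball zoo r by apply: ball_sub; lra.
have zB : ball zoo (r - h) `<=` ball (coo j) (q j).
  by apply: ball_sub; rewrite metric_sym; lra.
have mb y s : measurable (ball y s : set (borel Xoo)) by exact: ball_borel.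
have goo1 : `|\int[muoo]_(y in ball zoo r) goo y - \int[muoo]_(y in ball (coo j) (q j)) goo y| <= e / 6.
  apply: le_trans (norm_Rintegral_setD (mb _ _) (mb _ _) Bz gz) _.
  rewrite (Rintegral_setD (mb _ _) (mb _ _) Bz gzn); apply: le_trans n1.
  rewrite lerD2l lerN2; apply: (ge0_subset_Rintegral (mb _ _) (mb _ _) zB) => //.
  by apply: integrableS gzn.
have muoo1 : fine (muoo (ball zoo r)) - fine (muoo (ball (coo j) (q j))) <= dl.
  apply: le_trans n2; rewrite lerD2l lerN2 fine_le ?ball_fin_num//.
  exact: subset_measure.
have rq : mdist xoo zoo < rho - r by lra.
have N1 := near_dist_lt H zc (@cc j) dq.
have N2 := near_dist_lt H (pmGH_base H) zc rq.
have /cvgrPdist_le/(_ _ dl0) N3 := fine_ball_cvg H muoo_ball r0 zc.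
have /cvgrPdist_le/(_ _ dl0) N4 := fine_ball_cvg H muoo_ball (q0 j) (@cc j).
have /cvgrPdist_le/(_ _ e6) N5 := @Rintegral_base_ball_cvg j.
near=> i.
have N1i : mdist (z i) (c j i) < r - q j by near: i.
have N2i : mdist (x i) (z i) < rho - r by near: i.
have N3i : `|fine (muoo (ball zoo r)) - fine (mu i (ball (z i) r))| <= dl by near: i.
have N4i : `|fine (muoo (ball (coo j) (q j))) - fine (mu i (ball (c j i) (q j)))| <= dl by near: i.
have N5i : `|\int[muoo]_(y in Doo `&` Boo j) goo y - \int[mu i]_(y in D i `&` B i j) g y| <= e / 6 by near: i.
have ziD : ball (z i) r `<=` D i by apply: ball_sub; lra.
have Bzi : ball (c j i) (q j) `<=` ball (z i) r by apply: ball_sub; lra.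
rewrite (setIidr (subset_trans Bz zD)) (setIidr (subset_trans Bzi ziD)) in N5i.
have mbi (y : X i) s : measurable (ball y s : set (borel (X i))) by exact: ball_borel.
have giz : (mu i).-integrable (ball (z i) r : set (borel (X i))) (EFin \o @g i).
  exact: integrableS (mbi _ _) (mbi _ _) ziD (gi i).
(* Integrating the constant 1 turns the measure of the set difference into a difference of
   measures. *)
have onei := integrable_cst 1 (mbi (z i) r) (mu_ball (z i) r).
have := Rintegral_setD (mbi _ _) (mbi _ _) Bzi onei.
rewrite !Rintegral_cst ?mul1r//; last exact: measurableD.
move=> mudiff.
have gi1 : `|\int[mu i]_(y in ball (z i) r) g y - \int[mu i]_(y in ball (c j i) (q j)) g y| <=
    e / 6 + 3 * (e / 6).
  apply: le_trans (norm_Rintegral_setD (mbi _ _) (mbi _ _) Bzi giz) _.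
  apply: (le_trans (Rintegral_norm_le_trunc (k := k%:R) (mbi _ _) (mu_ball (x i) rho) (gi i) _ _ _)) => //.
    exact: measurableD.
    by move=> y [/ziD].
  apply: lerD; first exact: le_trans (g_tau i k) tauk.
  apply: (@le_trans _ _ (k%:R * (3 * dl))); last by rewrite mulrCA ler_wpM2l.
  rewrite ler_wpM2l// mudiff.
  by move: N3i N4i; rewrite !ler_norml => /andP[? ?] /andP[? ?]; lra.
move: goo1 N5i gi1; rewrite !ler_norml => /andP[? ?] /andP[? ?] /andP[? ?].
by apply/andP; split; lra.
Unshelve. all: by end_near. Qed.

Lemma average_ball_cvg z zoo r : cvgp z zoo -> 0 < r -> mdist xoo zoo + r < rho ->
  average (mu i) (@g i) (ball (z i) r) @[i --> \oo] --> average muoo goo (ball zoo r) /\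
  average muoo goo (ball zoo r) \is a fin_num.
Proof.
move=> zc r0 zr.
have zD : ball zoo r `<=` Doo by apply: ball_sub; exact: ltW.
have gz : muoo.-integrable (ball zoo r : set (borel Xoo)) (EFin \o goo).
  exact: integrableS (ball_borel _ _) (ball_borel _ _) zD gooi.
rewrite (average_fin (ball_borel _ _) (muoo_pos zoo r0) (muoo_ball zoo r) gz); split => //.
have zoo_pos : 0 < fine (muoo (ball zoo r)) by rewrite fine_gt0// muoo_pos// muoo_ball.
have mucvg := fine_ball_cvg H muoo_ball r0 zc.
have rq : mdist xoo zoo < rho - r by lra.
have ratio : (\int[mu i]_(y in ball (z i) r) g y) / fine (mu i (ball (z i) r))
    @[i --> \oo] --> (\int[muoo]_(y in ball zoo r) goo y) / fine (muoo (ball zoo r)).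
  by apply: cvgM; [exact: Rintegral_ball_cvg|apply: cvgV => //; rewrite gt_eqF].
suff eqn : \forall i \near \oo,
    ((\int[mu i]_(y in ball (z i) r) g y) / fine (mu i (ball (z i) r)))%:E =
    average (mu i) (@g i) (ball (z i) r).
  apply: (cvg_trans (near_eq_cvg eqn)).
  by apply: cvg_EFin; [exact: nearW|exact: ratio].
have N1 := near_dist_lt H (pmGH_base H) zc rq.
have N2 : \forall i \near \oo, 0 < fine (mu i (ball (z i) r)).
  by apply: (cvgr_gt _ mucvg).
near=> i.
have ziD : ball (z i) r `<=` D i.
  have : mdist (x i) (z i) < rho - r by near: i.
  by move=> ?; apply: ball_sub; lra.
have mi0 : 0 < fine (mu i (ball (z i) r)) by near: i.
rewrite average_fin//.
- exact: ball_borel.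
- by move: mi0; rewrite lt_neqAle => /andP[h _]; rewrite lt0e measure_ge0 andbT; apply: contraNneq h => ->.
- exact: integrableS (ball_borel _ _) (ball_borel _ _) ziD (gi i).
Unshelve. all: by end_near. Qed.

(** For each small r the averages converge as i grows, so their limits superior and inferior both
    equal the average of [goo]. The two functions of r are then identically 0 near 0. *)
Lemma weak_limit_weak_cvg : weak_cvg_on x rad psi mu muoo g goo Doo.
Proof.
move=> zoo; rewrite in_ballE => zrho z zc.
have key (f : R -> \bar R) : (forall r, 0 < r -> mdist xoo zoo + r < rho -> f r = 0%E) ->
    (0 <= limf_einf f 0^'+)%E.
  move=> f0; rewrite limf_einfE.
  have rz : 0 < rho - mdist xoo zoo by rewrite subr_gt0.
  pose V : set R := [set r | 0 < r /\ mdist xoo zoo + r < rho].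
  have V0 : 0^'+ V.
    near=> r; split; first by near: r; exact: nbhs_right_gt.
    by rewrite -ltrBrDl; near: r; exact: nbhs_right_lt.
  apply: (@le_trans _ _ (ereal_inf [set f r | r in V])).
    by apply: le_ereal_inf_tmp => _ [r [r0 zr] <-]; rewrite f0.
  by apply: ereal_sup_ubound; exists V.
by split; apply: key => r r0 zr;
  have [/cvg_limn_einf_sup[einf esup] fin] := average_ball_cvg zc r0 zr;
  rewrite ?einf ?esup subee.
Unshelve. all: by end_near. Qed.

Variable phi : nat -> nat.
Hypothesis goom : measurable_fun (Doo : set (borel Xoo)) goo.
Hypothesis goo_ae : {ae muoo, forall y, Doo y ->
  F (code Boo (phi j) y) / fine (muoo (cellY (code Boo (phi j) y))) @[j --> \oo] --> goo y}.

Let h t := F t / fine (muoo (cellY t)).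

(** On a null cell [F t] is an integral of [goo] over a null set, hence 0, in accordance with
    division by 0. *)
Let hm t : h t * fine (muoo (cellY t)) = F t.
Proof.
rewrite /h; have [mt|mt] := eqVneq (fine (muoo (cellY t))) 0; last by rewrite divfK.
have mct : measurable (cellY t : set (borel Xoo)) by exact: ball_celloo_borel.
rewrite mt mulr0 -gooF /Rintegral null_set_integral//.
- apply: measurable_funS (measurable_int muoo gooi) => //; exact: cell_sub.
- apply/eqP; rewrite -fine_eq0; first exact/eqP.
  by apply: (mu_bounded_fin muoo_ball mct); exact: cell_sub.
Qed.

Lemma weak_limit_powR r K : 1 < r ->
  (forall i, \int[mu i]_(y in D i) (`|g y| `^ r)%:E <= K%:E)%E ->
  (\int[muoo]_(y in Doo) (`|goo y| `^ r)%:E <= K%:E)%E.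
Proof.
move=> r1 gK.
apply: (ae_cvg_powR_bound (T := borel Xoo) (u := fun j y => h (code Boo (phi j) y))) => //.
  by move=> j; apply: measurable_funTS; exact: (measurable_code (T := borel Xoo) (@mBoo) h).
move=> j; set n := phi j; pose hr t := `|h t| `^ r.
have hri := integrable_code (T := borel Xoo) mDoo (@mBoo) (muoo_ball xoo rho) hr n mDoo (@subset_refl _ _).
rewrite -(fineK (integrable_fin_num mDoo hri)) lee_fin.
have /= := Rintegral_code (T := borel Xoo) mDoo (@mBoo) (muoo_ball xoo rho) hr n.
rewrite /Rintegral => ->.
(* The tangent is taken at the limit density [h t], where it touches the power; hence [w i t] tends
   to [hr t] times the measure of the cell without loss. *)
pose w i t := r * `|h t| `^ (r - 1) * `|\int[mu i]_(y in cellX i t) g y| -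
  (r - 1) * `|h t| `^ r * fine (mu i (cellX i t)).
have wK i : \sum_(t <- words n) w i t <= K.
  have gmi : measurable_fun (D i : set (borel (X i))) (@g i).
    by apply/measurable_EFinP; exact: measurable_int (gi i).
  have gri := integrable_powR_Lp gmi (gK i).
  apply: (@le_trans _ _ (\sum_(t <- words n) \int[mu i]_(y in cellX i t) `|g y| `^ r)).
    apply: ler_sum => t _.
    by apply: (Rintegral_powR_tangent (@mD i) (mu_ball _ _) r1 gmi (gK i)) => //;
      [exact: ball_cell_borel|exact: cell_sub].
  rewrite (Rintegral_words (@mD i) (@mB i) n gri) -lee_fin fineK//.
  exact: (integrable_fin_num (@mD i) gri).
have wcvg : \sum_(t <- words n) w i t @[i --> \oo] -->
    \sum_(t <- words n) hr t * fine (muoo (cellY t)).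
  apply: cvg_sum_seq => t.
  have -> : hr t * fine (muoo (cellY t)) =
      r * `|h t| `^ (r - 1) * `|F t| - (r - 1) * `|h t| `^ r * fine (muoo (cellY t)).
    have -> : `|F t| = `|h t| * fine (muoo (cellY t)).
      by rewrite -{1}(hm t) normrM [X in _ * X]ger0_norm// fine_ge0.
    by rewrite mulrA -mulrBl powR_tangent_eq.
  by apply: cvgB; apply: cvgMr; [apply: cvg_norm; exact: gF|exact: cell_cvg].
by apply: (ler_cvg_to wcvg (cvg_cst K)); apply: nearW.
Qed.

Lemma weak_limit_bounded M : 0 <= M ->
  (forall i, {ae mu i, forall y, D i y -> `|g y| <= M}) ->
  {ae muoo, forall y, Doo y -> `|goo y| <= M}.
Proof.
move=> M0 gM.
have FM t : `|F t| <= M * fine (muoo (cellY t)).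
  have Mm : M * fine (mu i (cellX i t)) @[i --> \oo] --> M * fine (muoo (cellY t)).
    by apply: cvgMr; exact: cell_cvg.
  apply: (ler_cvg_to (cvg_norm (@gF t)) Mm); apply: nearW => i.
  have gmi : measurable_fun (D i : set (borel (X i))) (@g i).
    by apply/measurable_EFinP; exact: measurable_int (gi i).
  have mct : measurable (cellX i t : set (borel (X i))) by exact: ball_cell_borel.
  have ctD : cellX i t `<=` D i by exact: cell_sub.
  apply: le_trans (Rintegral_ae_bounded (@mD i) (mu_ball _ _) M0 gmi (gM i) mct ctD).
  by apply: le_normr_Rintegral => //; exact: integrableS (gi i).
have hM t : `|h t| <= M by apply: (density_bound FM) => // s; rewrite fine_ge0.
move: goo_ae; apply: (filterS (Filter := ae_filter_ringOfSetsType muoo)) => y + Dy.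
move=> /(_ Dy) uy; apply: (ler_cvg_to (cvg_norm uy) (cvg_cst M)).
by apply: nearW => j; exact: hM.
Qed.

End weak_limit.

(** * Subsequences *)

Lemma homo_ltn_ge_id (s : nat -> nat) : {homo s : m n / (m < n)%N} -> forall n, (n <= s n)%N.
Proof. by move=> hs; elim=> // n IH; exact: leq_ltn_trans IH (hs _ _ (ltnSn n)). Qed.

Lemma homo_ltn_cvg (s : nat -> nat) : {homo s : m n / (m < n)%N} -> s n @[n --> \oo] --> \oo.
Proof.
move=> hs A [N _ NA]; exists N => // n /= Nn; apply: NA => /=.
exact: leq_trans Nn (homo_ltn_ge_id hs n).
Qed.

(* A cluster point in the compact product of the intervals [[- M a, M a]]
   provides simultaneous limits of countably many bounded sequences. *)
Lemma simultaneous_subsequence (R : realType) (I : countType) (u : I -> nat -> R) (M : I -> R) :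
  (forall a i, `|u a i| <= M a) ->
  exists2 s : nat -> nat, {homo s : m n / (m < n)%N} &
    forall a, cvgn (fun j => u a (s j)).
Proof.
move=> uM.
pose P := prod_topology (fun _ : I => (R : topologicalType)).
pose K : set P := [set f : P | forall a, `[- M a, M a]%classic (f a)].
have cK : compact K.
  apply: (@tychonoff I (fun=> R : topologicalType) (fun a => `[- M a, M a]%classic)).
  by move=> a; exact: segment_compact.
pose w i : P := fun a => u a i.
have wK : (w @ \oo) K.
  exists 0%N => // i _ a.
  have : w i a \in `[- M a, M a] by rewrite in_itv /= -ler_norml; exact: uM.
  by [].
have [l [_ lcl]] := cK _ _ wK.
(* A neighborhood in the product topology controls finitely many coordinates, here those with pickle
   code at most [j], and every tail of [w] meets it. *)
have step N j : exists n, (N < n)%N /\ forall a, (pickle a <= j)%N -> `|l a - u a n| < j.+1%:R^-1.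
  have e0 : 0 < j.+1%:R^-1 :> R by rewrite invr_gt0.
  have nl : nbhs l [set f : P | forall a, (pickle a <= j)%N -> `|l a - f a| < j.+1%:R^-1].
    have : \forall f \near l, forall b, b \in iota 0 j.+1 ->
        forall a, unpickle b = Some a -> `|l a - f a| < j.+1%:R^-1.
      apply: (near_seq (nbhs_filter l)) => b _.
      case ub : (unpickle b : option I) => [a|]; last exact: (filterE (nbhs_filter l)).
      have pc : {for l, continuous (fun f : P => f a)} by exact: (@proj_continuous _ (fun=> R : topologicalType)).
      have /cvgrPdist_lt/(_ _ e0) := pc.
      by apply: (filterS (Filter := nbhs_filter l)) => f fa a' [<-].
    apply: (filterS (Filter := nbhs_filter l)) => f fP a aj; apply: (fP (pickle a)); last exact: pickleK.
    by rewrite mem_iota add0n ltnS.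
  have tail : (w @ \oo) [set f | exists2 n, (N < n)%N & f = w n].
    by exists N.+1 => // n /= Nn; exists n.
  by have [f [[n Nn ->] fl]] := lcl _ _ tail nl; exists n.
have [nxt nxtP] := choice (fun Nj : nat * nat => step Nj.1 Nj.2).
pose s := fix s j := if j is j'.+1 then nxt (s j', j) else nxt (0%N, 0%N).
have sS j : (s j < s j.+1)%N by have [] := nxtP (s j, j.+1).
have hs : {homo s : m n / (m < n)%N} by apply: homo_ltn => //; exact: ltn_trans.
have sl j a : (pickle a <= j)%N -> `|l a - u a (s j)| < j.+1%:R^-1.
  by case: j => [|j]; [have [_ +] := nxtP (0%N, 0%N)|have [_ +] := nxtP (s j, j.+1)]; apply.
exists s => // a; apply/cvg_ex; exists (l a); apply/cvgrPdist_lt => e e0.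
near=> j; apply: (@lt_trans _ _ (j.+1%:R^-1)).
  by apply: sl; near: j; exact: nbhs_infty_ge.
by near: j; exact: (near_infty_natSinv_lt (PosNum e0)).
Unshelve. all: by end_near. Qed.

Section subsequence.
Context {R : realType} (X : nat -> pmetricType R) (Xoo : pmetricType R).
Variables (x : forall i, X i) (xoo : Xoo).
Variables (rad : nat -> R) (psi : forall i, X i -> Xoo).
Variables (mu : forall i, {measure set (borel (X i)) -> \bar R})
  (muoo : {measure set (borel Xoo) -> \bar R}) (eps : nat -> R).
Hypothesis H : pmGH_cvg x xoo rad psi mu muoo eps.
Variables (s : nat -> nat) (hs : {homo s : m n / (m < n)%N}).

Let sinj j k : s j = s k -> j = k.
Proof.
by move=> sjk; case: (ltngtP j k) => // /hs; rewrite sjk ltnn.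
Qed.

Let sle j k : (s j <= s k)%N -> (j <= k)%N.
Proof. by case: (leqP j k) => // /hs; rewrite ltnNge => /negP nsjk /nsjk. Qed.

(** Convergence of measures is assumed along full sequences of points. A sequence given along [s] is
    therefore interleaved with an arbitrary one converging to the same point. *)
Lemma cvg_point_extend (y : forall j, X (s j)) yoo :
  cvg_point (fun j => x (s j)) (fun j => rad (s j)) (fun j => @psi (s j)) y yoo ->
  exists2 y' : forall i, X i, cvg_point x rad psi y' yoo & forall j, y' (s j) = y j.
Proof.
move=> [yb yc]; have [z [zb zc]] := ex_cvg_point H yoo.
(* The cast moves a point of [X (s j)] to [X i] along s j = i. Since [s] is injective and equality
   proofs on [nat] are unique, it disappears at [s j]. *)
pose y' i : X i := match pselect (exists j, s j = i) with
  | left h => ecast i (X i) (projT2 (cid h)) (y (projT1 (cid h)))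
  | right _ => z i end.
have y'E j : y' (s j) = y j.
  rewrite /y'; case: pselect => [h|[]]; last by exists j.
  case: (cid h) => k /= e; have kj := sinj e; case: _ / kj e => e.
  by move: (svalP _) => /= e'; rewrite (eq_irrelevance e' erefl).
have y'N i : ~ (exists j, s j = i) -> y' i = z i by rewrite /y'; case: pselect.
have near_y' (P : forall i, X i -> Prop) : (\forall j \near \oo, P (s j) (y j)) ->
    (\forall i \near \oo, P i (z i)) -> \forall i \near \oo, P i (y' i).
  move=> [N _ NP] [N' _ N'P]; exists (maxn (s N) N') => // i /=.
  rewrite geq_max => /andP[sNi N'i]; have [[j ji]|h] := pselect (exists j, s j = i).
    by case: _ / ji sNi {N'i} => sNj; rewrite y'E; apply: NP; exact: sle.
  by rewrite y'N//; exact: N'P.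
exists y' => //; split; first exact: (near_y' (fun i => ball (x i) (rad i))).
apply/metricType_numDomainType.cvgrPdist_lt => e e0.
move/metricType_numDomainType.cvgrPdist_lt/(_ _ e0) : yc.
move/metricType_numDomainType.cvgrPdist_lt/(_ _ e0) : zc => zc yc.
exact: (near_y' (fun i yi => mdist yoo (psi yi) < e)).
Qed.

Lemma cvg_point_subseq y yoo : cvg_point x rad psi y yoo ->
  cvg_point (fun j => x (s j)) (fun j => rad (s j)) (fun j => @psi (s j))
    (fun j => y (s j)) yoo.
Proof.
move=> [yb yc]; split; first exact: (homo_ltn_cvg hs yb).
exact: (cvg_comp _ _ (homo_ltn_cvg hs) yc).
Qed.

Lemma pmGH_cvg_subseq :
  pmGH_cvg (fun j => x (s j)) xoo (fun j => rad (s j)) (fun j => @psi (s j))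
    (fun j => mu (s j)) muoo (fun j => eps (s j)).
Proof.
have scvg := homo_ltn_cvg hs; split.
- exact: (cvg_comp _ _ scvg (pmGH_eps H)).
- exact: (cvg_comp _ _ scvg (pmGH_rad H)).
- by move=> j; exact: (pmGH_maps H).
- by move=> j; exact: (pmGH_dist H).
- by move=> j; exact: (pmGH_dense H).
- exact: cvg_point_subseq (pmGH_base H).
- move=> r y yoo r0 /cvg_point_extend[y' y'c y'E].
  under eq_fun do rewrite -y'E.
  exact: (cvg_comp _ _ scvg (pmGH_meas H r0 y'c)).
Qed.

End subsequence.

(** * Weak compactness *)

Lemma trunc0 (R : realDomainType) (t : R) : trunc 0 t = 0.
Proof. by rewrite /trunc normr_le0; case: eqP. Qed.

Lemma radon_ball_lty (R : realType) (X : pmetricType R)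
    (mu : {measure set (borel X) -> \bar R}) y r :
  proper_space X -> radon_measure mu -> (mu (ball y r) < +oo)%E.
Proof.
move=> pX [cfin _ _]; apply: le_lt_trans (cfin _ (pX y r)).
apply: subset_measure; [exact: ball_borel|exact: cball_borel|].
by move=> z; rewrite in_ballE => /ltW.
Qed.

(** If some ball were null, repeated doubling would yield a null ball containing the unit ball
    around [x0]. The constant depends on the final radius, but it multiplies 0. *)
Lemma doubling_ball_gt0 (R : realType) (X : pmetricType R)
    (mu : {measure set (borel X) -> \bar R}) (x0 : X) :
  (forall rhat : R, 0 < rhat -> exists C : R, doubling_below mu C rhat) ->
  (0 < mu (ball x0 1))%E -> forall y r, 0 < r -> (0 < mu (ball y r))%E.
Proof.
move=> dbl x01 y r r0; rewrite lt0e measure_ge0 andbT; apply/eqP => mu0.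
have [n yn] : exists n : nat, 1 + mdist y x0 <= 2 ^+ n * r.
  have [n _ /(_ n (leqnn n)) /= nr] := nbhs_infty_ger ((1 + mdist y x0) / r).
  exists n; rewrite -ler_pdivrMr// (le_trans nr)// -natrX ler_nat.
  exact/ltnW/ltn_expl.
have [|C Cdbl] := dbl (2 ^+ n * r); first by rewrite mulr_gt0// exprn_gt0.
have null k : (k <= n)%N -> mu (ball y (2 ^+ k * r)) = 0%E.
  elim: k => [|k IH] kn; first by rewrite expr0 mul1r.
  apply/eqP; rewrite eq_le measure_ge0 andbT exprS -mulrA.
  apply: (le_trans (Cdbl y _ _ _)).
  - by rewrite mulr_gt0// exprn_gt0.
  - by rewrite ltr_pM2r// ltr_eXn2l// ltr1n.
  - by rewrite IH ?mule0// ltnW.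
have : (mu (ball x0 1) <= 0)%E.
  rewrite -(null n (leqnn n)); apply: subset_measure; [exact: ball_borel..|].
  by apply: ball_sub; rewrite addrC.
by rewrite leNgt x01.
Qed.

Lemma proper_dense_balls (R : realType) (X : pmetricType R) (x0 : X) :
  proper_space X -> exists (c : nat -> X) (q : nat -> R), (forall j, 0 < q j) /\
    forall (w : X) (s e : R), 0 < s -> 0 < e ->
      exists j, mdist w (c j) < e /\ `|q j - s| < e.
Proof.
move=> pX.
have net (m : nat) : exists l : seq X, forall w, mdist x0 w <= m%:R ->
    exists2 y, y \in l & mdist y w < m.+1%:R^-1.
  have := pX x0 m%:R; rewrite compact_cover => cK.
  have [|z Kz|E _ Ecov] := cK X setT (fun y => ball y m.+1%:R^-1).
  - by move=> y _; exact: open_ball_metric.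
  - by exists z => //; rewrite in_ballE mdistxx invr_gt0.
  exists (finmap.enum_fset E) => w /Ecov[y yE]; rewrite in_ballE => yw.
  by exists y.
have [L LP] := choice net.
(* The four numbers are the index of a net, a position in it, and the numerator and denominator of a
   radius, both less one. *)
pose get j : nat * nat * nat * nat := odflt (0, 0, 0, 0)%N (unpickle j).
pose c j := nth x0 (L (get j).1.1.1) (get j).1.1.2.
pose q j : R := (get j).1.2.+1%:R / (get j).2.+1%:R.
exists c, q; split; first by move=> j; rewrite divr_gt0.
move=> w s e s0 e0.
near \oo => m.
have me : m.+1%:R^-1 < e by near: m; exact: (near_infty_natSinv_lt (PosNum e0)).
have mw : mdist x0 w <= m%:R by near: m; exact: nbhs_infty_ger.
have [y yL yw] := LP m w mw.
(* The radius (a + 1) / (m + 1) is positive and exceeds [s] by at most 1 / (m + 1). *)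
pose a := Num.truncn (s * m.+1%:R).
exists (pickle (m, index y (L m), a, m)).
rewrite /c /q /get pickleK /= nth_index//; split.
  by rewrite metric_sym (lt_trans yw).
apply: le_lt_trans me.
have sm0 : 0 <= s * m.+1%:R by rewrite mulr_ge0// ltW.
have /andP[a1 a2] := truncn_itv sm0.
have m0 : 0 < m.+1%:R :> R by [].
rewrite -[s in X in `|X|](mulfK (lt0r_neq0 m0)) -mulrBl normrM [X in _ * X]ger0_norm ?invr_ge0//.
rewrite ler_piMl ?invr_ge0//; rewrite ger0_norm; last by rewrite subr_ge0 ltW.
by rewrite -natr1 lerBlDl lerD2r.
Unshelve. all: by end_near. Qed.

Section weak_compactness.
Context {R : realType} (X : nat -> pmetricType R) (Xoo : pmetricType R).
Variables (x : forall i, X i) (xoo : Xoo).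
Variables (rad : nat -> R) (psi : forall i, X i -> Xoo).
Variables (mu : forall i, {measure set (borel (X i)) -> \bar R})
  (muoo : {measure set (borel Xoo) -> \bar R}) (eps : nat -> R).
Hypothesis H : pmGH_cvg x xoo rad psi mu muoo eps.
Hypothesis mu_ball : forall i y r, (mu i (ball y r) < +oo)%E.
Hypothesis muoo_ball : forall y r, (muoo (ball y r) < +oo)%E.
Hypothesis muoo_pos : forall y r, 0 < r -> (0 < muoo (ball y r))%E.
Hypothesis muoo_reg : forall U : set Xoo, open U ->
  muoo U = ereal_sup [set muoo K | K in [set K : set Xoo | compact K /\ K `<=` U]].
Hypotheses (Xoo_proper : proper_space Xoo) (Xoo_geodesic : geodesic_space Xoo).
Variables (C r0 : R).
Hypotheses (C0 : 0 <= C) (r0_gt0 : 0 < r0) (dbl : doubling_below muoo C r0).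

(* Uniform integrability of the [g i] is expressed by a common bound [tau] on
   their truncation errors. *)
Variables (rho : R) (g : forall i, X i -> R) (tau : nat -> R).
Hypothesis rho0 : 0 < rho.
Hypothesis gi : forall i,
  (mu i).-integrable (ball (x i) rho : set (borel (X i))) (EFin \o @g i).
Hypothesis g_tau : forall i k,
  \int[mu i]_(y in ball (x i) rho) `|g y - trunc k%:R (g y)| <= tau k.
Hypothesis tau0 : tau k @[k --> \oo] --> 0.

Lemma weak_compactness : exists (goo : Xoo -> R) (s : nat -> nat),
  [/\ {homo s : m n / (m < n)%N},
      measurable_fun (ball xoo rho : set (borel Xoo)) goo,
      weak_cvg_on (fun j => x (s j)) (fun j => rad (s j)) (fun j => @psi (s j))
        (fun j => mu (s j)) muoo (fun j => @g (s j)) goo (ball xoo rho),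
      forall r K, 1 < r ->
        (forall i, \int[mu i]_(y in ball (x i) rho) (`|g y| `^ r)%:E <= K%:E)%E ->
        (\int[muoo]_(y in ball xoo rho) (`|goo y| `^ r)%:E <= K%:E)%E &
      forall M, 0 <= M ->
        (forall i, {ae mu i, forall y, ball (x i) rho y -> `|g y| <= M}) ->
        {ae muoo, forall y, ball xoo rho y -> `|goo y| <= M}].
Proof.
have [coo [q [q0 cq_dense]]] := @proper_dense_balls R Xoo xoo Xoo_proper.
pose c j := projT1 (cid (ex_cvg_point H (coo j))).
have cc j : cvg_point x rad psi (c j) (coo j) := projT2 (cid (ex_cvg_point H (coo j))).
have muoo_sphere (y : Xoo) r : 0 < r -> muoo [set z | mdist y z = r] = 0%E.
  exact: (sphere_null muoo_ball y Xoo_proper Xoo_geodesic C0 r0_gt0 dbl).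
pose ci i t := @ball_cell R X x rho c q i t.
(* [None] stands for [g] and [Some k] for its truncation at level [k]. Paired with words they form a
   countable index set, so one extraction serves all. *)
pose u (a : option nat * seq bool) i := \int[mu i]_(y in ci i a.2)
  if a.1 is Some k then trunc k%:R (g y) else g y.
have mD i : measurable (ball (x i) rho : set (borel (X i))) by exact: ball_borel.
(* [tau 0] bounds the L^1 norm of every [g i], since truncation at level 0 gives 0. *)
have u_tau a i : `|u a i| <= tau 0.
  have mc : measurable (ci i a.2 : set (borel (X i))) by exact: ball_cell_borel.
  have cD : ci i a.2 `<=` ball (x i) rho by exact: cell_sub.
  have gn := integrable_norm (gi i).
  have gc : (mu i).-integrable (ci i a.2 : set (borel (X i))) (EFin \o (fun y => `|g y|)).
    exact: integrableS gn.
  have fi : (mu i).-integrable (ball (x i) rho : set (borel (X i)))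
      (EFin \o (fun y => if a.1 is Some k then trunc k%:R (g y) else g y)).
    by case: (a.1) => [k|]; [exact: (integrable_trunc (mD i) (gi i))|exact: gi].
  have fc : (mu i).-integrable (ci i a.2 : set (borel (X i)))
      (EFin \o (fun y => if a.1 is Some k then trunc k%:R (g y) else g y)).
    exact: integrableS fi.
  apply: (le_trans (le_normr_Rintegral mc fc)).
  apply: (@le_trans _ _ (\int[mu i]_(y in ci i a.2) `|g y|)).
    apply: le_Rintegral => //; first exact: (integrable_norm fc).
    by move=> y _; case: (a.1) => // k; exact: norm_trunc_le.
  apply: (@le_trans _ _ (\int[mu i]_(y in ball (x i) rho) `|g y|)).
    by apply: (ge0_subset_Rintegral (mD i) mc cD gn) => y _; exact: normr_ge0.
  apply: le_trans (g_tau i 0%N); rewrite le_eqVlt; apply/orP; left; apply/eqP.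
  by apply: eq_Rintegral => y _; rewrite trunc0 subr0.
have [s hs us] := simultaneous_subsequence u_tau.
have Hs := pmGH_cvg_subseq H hs.
have ccs j := cvg_point_subseq hs (cc j).
pose F t := limn (fun j => u (None, t) (s j)).
pose Fk k t := limn (fun j => u (Some k, t) (s j)).
have mu_ball' i y r : (mu (s i) (ball y r) < +oo)%E by exact: mu_ball.
have cell_cvg := ball_cell_cvg Hs mu_ball' muoo_ball muoo_reg muoo_sphere C0 r0_gt0 dbl rho0 ccs q0.
have gF t : \int[mu (s i)]_(y in ci (s i) t) g y @[i --> \oo] --> F t by exact: us.
have gFk k t : \int[mu (s i)]_(y in ci (s i) t) trunc k%:R (g y) @[i --> \oo] --> Fk k t.
  exact: us.
have gis i := gi (s i).
have gtaus i k := g_tau (s i) k.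
have [goo [phi [goom gooi gooae gooF]]] :=
  weak_limit_density mu_ball' muoo_ball cell_cvg gis gtaus tau0 gF gFk.
exists goo, s; split => //.
- exact: (weak_limit_weak_cvg Hs mu_ball' muoo_ball muoo_pos ccs q0 cq_dense
    gis gtaus tau0 gF gooi gooF).
- move=> r K r1 gK.
  exact: (weak_limit_powR mu_ball' muoo_ball cell_cvg gis gF gooi gooF goom gooae r1).
- move=> M M0 gM.
  exact: (weak_limit_bounded mu_ball' cell_cvg gis gF gooae M0).
Qed.

End weak_compactness.

(** * Finite and infinite exponents *)

Lemma powR_decay (R : realType) (K s : R) : 0 <= K -> 0 < s ->
  K / k%:R `^ s @[k --> \oo] --> 0.
Proof.
move=> K0 s0; apply/cvgrPdist_lt => e e0.
pose A := ((K + 1) / e) `^ s^-1.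
have Ke : 0 < (K + 1) / e by rewrite divr_gt0// ltr_wpDl.
have A0 : 0 < A by rewrite powR_gt0.
near=> k; have Ak : A <= k%:R by near: k; exact: nbhs_infty_ger.
have Aks : (K + 1) / e <= k%:R `^ s.
  have -> : (K + 1) / e = A `^ s by rewrite -powRrM mulVf ?gt_eqF// powRr1// ltW.
  by apply: ge0_ler_powR; rewrite ?nnegrE// ltW.
have ks0 : 0 < k%:R `^ s by exact: lt_le_trans Aks.
rewrite sub0r normrN ger0_norm ?divr_ge0 ?(ltW ks0)// ltr_pdivrMr//.
rewrite mulrC -ltr_pdivrMr//; apply: lt_le_trans Aks.
by rewrite ltr_pM2r ?invr_gt0// ltrDl.
Unshelve. all: by end_near. Qed.

(* The index i <= oo is an [option nat], with [None] for i = oo. *)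
Theorem proposition3p19 (R : realType)
    (X : option nat -> pmetricType R) (x : forall i, X i) (rho : R)
    (v : forall i, {measure set (borel (X i)) -> \bar R})
    (eps rad : nat -> R) (psi : forall i : nat, X (Some i) -> X None)
    (p : \bar R) (g : forall i : nat, X (Some i) -> R) :
  (forall i, proper_space (X i)) ->
  (forall i, geodesic_space (X i)) ->
  0 < rho ->
  (forall i, radon_measure (v i)) ->
  pmGH_cvg (fun i => x (Some i)) (x None) rad psi
    (fun i => v (Some i)) (v None) eps ->
  [set: X None] <> [set x None] ->
  (forall rhat : R, 0 < rhat -> exists2 kappa : R, 0 <= kappa &
    forall i (r : R) (z : X i), 0 < r -> r < rhat ->
      (v i (ball z (2 * r)) <= (2 `^ kappa)%:E * v i (ball z r))%E) ->
  (forall i, v i (ball (x i) 1) = 1%E) ->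
  (1 < p)%E ->
  (forall i, in_Lp (v (Some i)) p (ball (x (Some i)) rho) (@g i)) ->
  (ereal_sup (range (fun i =>
    Lp_norm (v (Some i)) p (ball (x (Some i)) rho) (@g i))) < +oo)%E ->
  exists goo : X None -> R, exists s : nat -> nat,
    [/\ in_Lp (v None) p (ball (x None) rho) goo,
        {homo s : m n / (m < n)%N} &
        weak_cvg_on (fun j => x (Some (s j))) (fun j => rad (s j))
          (fun j => @psi (s j)) (fun j => v (Some (s j))) (v None)
          (fun j => @g (s j)) goo (ball (x None) rho)].
Proof.
move=> pX gX rho0 rad_v H _ dbl v1 p1 gp sup_oo.
have v_ball i (y : X i) r : (v i (ball y r) < +oo)%E.
  exact: radon_ball_lty (pX i) (rad_v i).
have dblC rhat : 0 < rhat -> exists C, 0 <= C /\ doubling_below (v None) C rhat.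
  move=> /dbl[kappa _ kappaP]; exists (2 `^ kappa); split; first exact: powR_ge0.
  by move=> z r; exact: kappaP.
have [C [C0 C_dbl]] := dblC 1 ltr01.
have v_pos y r : 0 < r -> (0 < v None (ball y r))%E.
  apply: (doubling_ball_gt0 (x0 := x None)); last by rewrite v1 lte01.
  by move=> rhat /dblC[C' [_ C'_dbl]]; exists C'.
have [_ _ v_reg] := rad_v None.
set L := ereal_sup _ in sup_oo.
have gL i : (Lp_norm (v (Some i)) p (ball (x (Some i)) rho) (@g i) <= L)%E.
  by apply: ereal_sup_ubound; exists i.
have L0 : (0 <= L)%E by apply: le_trans (gL 0%N); exact: Lnorm_ge0.
pose M := fine L.
have M0 : 0 <= M by rewrite fine_ge0.
have gM i : (Lp_norm (v (Some i)) p (ball (x (Some i)) rho) (@g i) <= M%:E)%E.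
  by rewrite fineK// ge0_fin_numE.
pose D i : set (borel (X (Some i))) := ball (x (Some i)) rho.
have mD i : measurable (D i) by exact: ball_borel.
have gm i : measurable_fun (D i) (@g i) by exact: in_Lp_measurable (gp i).
(* The measures of the balls converge, hence they have a common bound. *)
have [V V0 VP] : exists2 V : R, 0 <= V & forall i, fine (v (Some i) (D i)) <= V.
  have vcvg := fine_ball_cvg H (v_ball None) rho0 (pmGH_base H).
  have /cvg_seq_bounded[B [_ /(_ (B + 1))]] := cvgP _ vcvg.
  rewrite ltrDl => /(_ ltr01) VB; exists `|B + 1| => // i.
  by apply: le_trans (ler_norm _); apply: le_trans (ler_norm _) (VB i I).
(* Finite and infinite exponents differ only in how these three points are verified. *)
suff [gi [tau [tau0 g_tau]] Lp_goo] :
    [/\ forall i, (v (Some i)).-integrable (D i) (EFin \o g i),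
      exists tau : nat -> R, tau k @[k --> \oo] --> 0 /\ forall i k,
        \int[v (Some i)]_(y in D i) `|g i y - trunc k%:R (g i y)| <= tau k &
      forall goo : X None -> R,
        measurable_fun (ball (x None) rho : set (borel (X None))) goo ->
        (forall r K, 1 < r ->
          (forall i, \int[v (Some i)]_(y in D i) (`|g i y| `^ r)%:E <= K%:E)%E ->
          (\int[v None]_(y in ball (x None) rho) (`|goo y| `^ r)%:E <= K%:E)%E) ->
        (forall M, 0 <= M ->
          (forall i, {ae v (Some i), forall y, D i y -> `|g i y| <= M}) ->
          {ae v None, forall y, ball (x None) rho y -> `|goo y| <= M}) ->
        in_Lp (v None) p (ball (x None) rho) goo].
  have [goo [s [hs goom goo_weak goo_pow goo_bnd]]] := weak_compactness H
    (fun i => @v_ball (Some i)) (v_ball None) v_pos v_reg (pX None) (gX None)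
    C0 ltr01 C_dbl rho0 gi g_tau tau0.
  by exists goo, s; split => //; exact: Lp_goo.
have D_lty i : (v (Some i) (D i) < +oo)%E by exact: v_ball.
case: p p1 @L sup_oo @M L0 M0 gp gL gM => [r r1 L _ M _ M0 _ _ gM|_ L _ M _ M0 _ _ gM|//].
- have {}r1 : 1 < r by rewrite -lte_fin.
  have r0 : 0 < r by rewrite (lt_trans ltr01).
  pose K := M `^ r.
  have K0 : 0 <= K by exact: powR_ge0.
  have gK i : (\int[v (Some i)]_(y in D i) (`|g i y| `^ r)%:E <= K%:E)%E.
    have r_neq0 : r != 0 by rewrite gt_eqF.
    rewrite -(Lp_norm_powR (v (Some i)) (ball (x (Some i)) rho) (g i) r_neq0).
    rewrite -poweR_EFin; apply: gt0_ler_poweR.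
    - exact: ltW.
    - by rewrite in_itv/= leey andbT; exact: Lnorm_ge0.
    - by rewrite in_itv/= leey andbT lee_fin.
    - exact: gM.
  split.
  + by move=> i; exact: (integrable_Lp (mD i) (D_lty i) r1 (gm i) (gK i)).
  (* At k = 0 the quotient would be 0 by the convention on division, so the bound on the L^1 norm is
     used there. *)
  + exists (fun k => if k is 0%N then V + K else K / k%:R `^ (r - 1)); split.
      have rr : 0 < r - 1 by rewrite subr_gt0.
      apply: cvg_trans (powR_decay K0 rr); apply: near_eq_cvg.
      by exists 1%N => // -[].
    move=> i [|k]; last exact: (Rintegral_Lp_trunc (mD i) (D_lty i) r1 (gm i) (gK i)).
    apply: (@le_trans _ _ (\int[v (Some i)]_(y in D i) `|g i y|)).
      rewrite le_eqVlt; apply/orP; left; apply/eqP.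
      by apply: eq_Rintegral => y _; rewrite trunc0 subr0.
    apply: (le_trans (Rintegral_Lp_le (mD i) (D_lty i) r1 (gm i) (gK i))).
    by rewrite lerD2r.
  + move=> goo goom goo_pow _; exact: (in_Lp_powR (ball_borel _ _) r0 goom (goo_pow _ _ r1 gK)).
- have gae i : {ae v (Some i), forall y, D i y -> `|g i y| <= M}.
    by apply: Lp_norm_oo_ae; exact: gM.
  split.
  + by move=> i; exact: (integrable_ae_bounded (mD i) (D_lty i) M0 (gm i) (gae i)).
  (* Truncation at a level at least [M] changes the functions on a null set only. *)
  + exists (fun k => if M <= k%:R then 0 else M * V); split.
      apply: cvg_near_cst; near=> k.
      by have -> : M <= k%:R by near: k; exact: nbhs_infty_ger.
    move=> i k; case: ifPn => [Mk|].
      by rewrite (Rintegral_ae_bounded_trunc (mD i) (D_lty i) M0 (gm i) (gae i)).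
    move=> _; apply: (@le_trans _ _ (\int[v (Some i)]_(y in D i) `|g i y|)).
      have gi := integrable_ae_bounded (mD i) (D_lty i) M0 (gm i) (gae i).
      apply: le_Rintegral => //.
      * exact: (integrable_norm (integrable_sub_trunc (mD i) gi k%:R)).
      * exact: integrable_norm.
      * by move=> y _; rewrite /trunc; case: ifP; rewrite ?subrr ?normr0 ?subr0.
    apply: le_trans (Rintegral_ae_bounded (mD i) (D_lty i) M0 (gm i) (gae i) (mD i) (@subset_refl _ _)) _.
    by rewrite ler_wpM2l.
  + move=> goo goom _ goo_bnd; exact: (in_Lp_oo (ball_borel _ _) M0 goom (goo_bnd _ M0 gae)).
Unshelve. all: by end_near. Qed.
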